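(* Let $X$ be a non-degenerate real random variable such that $\varphi(t):=\log \mathbb{E}[e^{tX}]$ is finite for all $t\ge 0$. Let $c_1:=\varphi'(1)-\varphi(1)$ and let $0<c<c_1$. Let $\{X_{i,j}:(i,j)\in\mathbb{N}^2\}$ be independent copies of $X$, let $\{N_n\}_{n\in\mathbb{N}}$ be a sequence of natural numbers with $\lim_{n\to\infty}e^{-cn}N_n=1$, and let $Z_n=\sum_{i=1}^{N_n}\prod_{j=1}^n e^{X_{i,j}}$. Then there is no sequence $(a_n)_{n\in\mathbb{N}}$ of (nonzero) real numbers such that $Z_n/a_n\to1$ in probability as $n\to\infty$.
   Context: Non-degenerate means not almost surely constant. Under the hypothesis on $\varphi$, $\varphi$ is infinitely differentiable on $(0,\infty)$, and $c_1>0$. *)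

(* Defs.v *)
From HB Require Import structures.
From mathcomp Require Import all_boot all_order all_algebra.
From mathcomp Require Import all_classical all_reals all_analysis.

Set Implicit Arguments.
Unset Strict Implicit.
Unset Printing Implicit Defensive.

Import Order.TTheory GRing.Theory Num.Theory.
Import numFieldNormedType.Exports.

Local Open Scope classical_set_scope.
Local Open Scope ring_scope.

Definition nondegenerate_rv d (T : measurableType d) (R : realType)
    (P : probability T R) (X : T -> R) : Prop :=
  ~ exists b : R, {ae P, forall w, X w = b}.

(* phi(t) = log E[exp(t X)], extended-real valued: it is +oo where the
   expectation is infinite. *)
Definition cgf d (T : measurableType d) (R : realType)
    (P : probability T R) (X : T -> R) (t : R) : \bar R :=
  lne ('M_P X t).

(* c_1 = phi'(1) - phi(1). The derivative is meaningful only when phi is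
   finite near 1. *)
Definition critical_rate d (T : measurableType d) (R : realType)
    (P : probability T R) (X : T -> R) : R :=
  derive1 (fine \o cgf P X) 1 - fine (cgf P X 1).

(* Equality of laws is required on Borel sets only: the value of a measure on
   a non-measurable set carries no meaning, so equating the pushforwards as
   functions on all sets would be too strong. *)
Definition same_law d (T : measurableType d) d' (T' : measurableType d')
    (R : realType) (P : probability T R) (P' : probability T' R)
    (X : {RV P >-> R}) (Y : {RV P' >-> R}) : Prop :=
  forall B : set (measurableTypeR R), measurable B ->
    distribution P X B = distribution P' Y B.

Definition mutually_independent d (T : measurableType d) (R : realType)
    (P : probability T R) (I : eqType) (X : I -> {RV P >-> R}) : Prop :=
  forall (s : seq I) (B : I -> set (measurableTypeR R)),
    uniq s -> (forall k, measurable (B k)) ->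
    P (\bigcap_(k in [set` s]) (X k @^-1` B k)) =
      (\prod_(k <- s) P (X k @^-1` B k))%E.

Definition independent_copies d (T : measurableType d)
    d' (T' : measurableType d') (R : realType)
    (P : probability T R) (P' : probability T' R) (I : eqType)
    (X : I -> {RV P >-> R}) (Y : {RV P' >-> R}) : Prop :=
  mutually_independent X /\ forall k, same_law (X k) Y.

Definition cvg_in_probability d (T : measurableType d) (R : realType)
    (P : probability T R) (Y : nat -> T -> R) (l : R) : Prop :=
  forall eps : R, 0 < eps ->
    P [set w | eps <= `|Y n w - l|] @[n --> \oo] --> 0%E.

(* Z_n, with the rows i and columns j numbered from 0. *)
Definition Zsum d (T : measurableType d) (R : realType)
    (P : probability T R) (X : nat * nat -> {RV P >-> R}) (N : nat -> nat)
    (n : nat) (w : T) : R :=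
  \sum_(i < N n) \prod_(j < n) expR (X (nat_of_ord i, nat_of_ord j) w).

(* Main.v *)
Require Import Defs.
From HB Require Import structures.
From mathcomp Require Import all_boot all_order all_algebra.
From mathcomp Require Import all_classical all_reals all_analysis.
From mathcomp Require Import measurable_realfun.
From mathcomp Require Import ring lra.
Import Order.TTheory GRing.Theory Num.Theory.
Import numFieldNormedType.Exports.
Local Open Scope classical_set_scope.
Local Open Scope ring_scope.

(** Let [phi t = ln E[exp (t X)]], let [theta] in [(0, 1)] be the first solution
    of [theta * phi'(theta) - phi(theta) = c] and let [S] be a row sum. If
    [Z_n / a_n -> 1] then, the rows being independent, no term [exp S] exceeds
    [2 a_n] with probability tending to 1, so [N_n * P (S > ln (2 a_n)) -> 0]; hence
    [a_n] must be produced by the truncated expectation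
    [N_n * E[exp S; S <= ln (2 a_n) + K]] for any fixed [K].

    Take two disjoint compact intervals [A < B] charged by the law of [X].
    Moving one summand from [A] to [B] multiplies [exp S] by a factor bounded
    below, while under the [theta]-tilted law the numbers of summands in [A] and
    in [B] are in the ratio of the tilted masses, up to exponentially rare events.
    Since [theta < 1], exchanging shows that the part of [E[exp S; S <= z]] below
    [z - K] is at most [rho < 1] times the whole, so [E[exp S; S <= z]] is bounded
    by a multiple of [exp z * P (S > z - K)] plus a tilted error. With
    [z = ln (2 a_n) + K] both terms are [o(a_n / N_n)], a contradiction; for the
    error this uses [ln (2 a_n) >= n (phi'(theta) - e)], which follows from
    Cramer's lower bound at a tilt slightly below [theta]. *)

(** * Independence *)

Section Independence.
Context {R : realType} {d : measure_display} {T : measurableType d}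
  {P : probability T R}.
Implicit Types (U V : T -> R) (L : seq (T -> R)) (B : nat -> set R).

(** Functions are kept in a list and sets are indexed by position, so that shifting [B] by [S]
    matches passing to the tail and inductions on the list compute. *)
Fixpoint joint_event L B : set T :=
  if L is U :: L' then U @^-1` B 0%N `&` joint_event L' (B \o S) else setT.

Fixpoint prod_prob L B : \bar R :=
  if L is U :: L' then (P (U @^-1` B 0%N) * prod_prob L' (B \o S))%E else 1%E.

Definition measurable_seq L :=
  forall k, measurable_fun [set: T] (nth (fun=> 0) L k).

(** Only full intersections are required: taking [setT] at some positions yields the product rule
    for every subfamily. *)
Definition indep_seq L := measurable_seq L /\
  forall B, (forall k, measurable (B k)) ->
    P (joint_event L B) = prod_prob L B.

Lemma measurable_seq_cons U L : measurable_seq (U :: L) <->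
  measurable_fun [set: T] U /\ measurable_seq L.
Proof.
split=> [h|[hU hL] [|k]]; [split; [exact: (h 0%N) | by move=> k; exact: (h k.+1)] | exact: hU | exact: hL].
Qed.

Lemma measurable_seq_cat L1 L2 : measurable_seq (L1 ++ L2) <->
  measurable_seq L1 /\ measurable_seq L2.
Proof.
elim: L1 => [|U L1 IH] /=.
  by split=> [h|[]//]; split => // k; rewrite nth_nil; exact: measurable_cst.
rewrite !measurable_seq_cons IH; tauto.
Qed.

Lemma joint_event_cat L1 L2 B : joint_event (L1 ++ L2) B =
  joint_event L1 B `&` joint_event L2 (fun k => B (size L1 + k)%N).
Proof.
elim: L1 B => [|U L1 IH] B /=; first by rewrite setTI.
by rewrite IH setIA.
Qed.

Lemma prod_prob_cat L1 L2 B : prod_prob (L1 ++ L2) B =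
  (prod_prob L1 B * prod_prob L2 (fun k => B (size L1 + k)%N))%E.
Proof.
elim: L1 B => [|U L1 IH] B /=; first by rewrite mul1e.
by rewrite IH muleA.
Qed.

Lemma measurable_preimage U (A : set R) :
  measurable_fun [set: T] U -> measurable A -> measurable (U @^-1` A).
Proof. by move=> mU mA; rewrite -[X in measurable X]setTI; exact: mU. Qed.

Lemma measurable_joint_event L B : measurable_seq L ->
  (forall k, measurable (B k)) -> measurable (joint_event L B).
Proof.
elim: L B => [|U L IH] B //= /measurable_seq_cons[mU mL] mB.
by apply: measurableI; [exact: measurable_preimage | apply: IH => // k; exact: mB].
Qed.

Lemma indep_seq_tail U L : indep_seq (U :: L) -> indep_seq L.
Proof.
move=> [/measurable_seq_cons[mU mL] h]; split => // B mB.
have := h (fun k => if k is k'.+1 then B k' else setT).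
rewrite /= preimage_setT setTI probability_setT mul1e; apply.
by case=> //; exact: measurableT.
Qed.

(** Intersection and product commute. Rotations bring any block to the front, so composing and
    merging need only be treated at the head of the list. *)
Lemma indep_seq_rot U L : indep_seq (U :: L) -> indep_seq (rcons L U).
Proof.
move=> [/measurable_seq_cons[mU mL] h]; split => [|B mB].
  rewrite -cats1; apply/measurable_seq_cat; split => //.
  apply/measurable_seq_cons; split => // k; rewrite nth_nil; exact: measurable_cst.
rewrite -cats1 joint_event_cat prod_prob_cat /= setIT mule1 addn0 setIC muleC.
have := h (fun k => if k is k'.+1 then B k' else B (size L)).
by apply; case.
Qed.

Lemma indep_seq_rot_cat L1 L2 : indep_seq (L1 ++ L2) -> indep_seq (L2 ++ L1).
Proof.
elim: L1 L2 => [|U L1 IH] L2 /=; first by rewrite cats0.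
by move=> /indep_seq_rot; rewrite rcons_cat => /IH; rewrite cat_rcons.
Qed.

Lemma indep_seq_comp (f : R -> R) U L : measurable_fun [set: R] f ->
  indep_seq (U :: L) -> indep_seq ((f \o U) :: L).
Proof.
move=> mf [/measurable_seq_cons[mU mL] h]; split => [|B mB].
  by apply/measurable_seq_cons; split => //; exact: measurableT_comp.
apply: (h (fun k => if k is k'.+1 then B k else f @^-1` B 0%N)) => -[|k] //.
by rewrite -[X in measurable X]setTI; exact: mf.
Qed.

Lemma indep_seq_map (f : R -> R) L : measurable_fun [set: R] f ->
  indep_seq L -> indep_seq [seq f \o U | U <- L].
Proof.
(* The induction carries an accumulator: each function is composed with [f] at the head and then
   rotated to the end of the list. *)
move=> mf; rewrite -{1}(cats0 L) -[X in _ -> indep_seq X](cat0s).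
elim: L [::] => [|U L IH] L' /=; first by rewrite cats0.
move=> /(indep_seq_comp _ _ _ mf)/indep_seq_rot; rewrite rcons_cat => /IH.
by rewrite cat_rcons.
Qed.

Lemma indep_pair_law (U V : {RV P >-> R}) (E : set T) : measurable E ->
  (forall A1 A2, measurable A1 -> measurable A2 ->
    P (U @^-1` A1 `&` (V @^-1` A2 `&` E)) =
    (P (U @^-1` A1) * (P (V @^-1` A2) * P E))%E) ->
  forall C : set (R * R), measurable C ->
  P ((fun w => (U w, V w)) @^-1` C `&` E) =
  ((distribution P U \x distribution P V) C * P E)%E.
Proof.
move=> mE h C mC; set UV := fun w => (U w, V w).
have mUV : measurable_fun [set: T] UV by exact: measurable_fun_pair.
have [PE0|PE0] := eqVneq (P E) 0%E.
  rewrite PE0 mule0; apply/eqP; rewrite eq_le measure_ge0 andbT -PE0.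
  apply: le_measure; rewrite ?inE //.
  by apply: measurableI => //; rewrite -[X in measurable X]setTI; apply: mUV.
have PEfin : P E \is a fin_num by exact: fin_num_measure.
have PEgt0 : 0 < fine (P E).
  by rewrite fine_gt0// lt0e PE0 measure_ge0 ltey_eq PEfin.
have r_ge0 : 0 <= (fine (P E))^-1 by rewrite invr_ge0 ltW.
pose r := NngNum r_ge0.
pose nu0 : {measure set (R * R) -> \bar R} :=
  @measure_function_pushforward__canonical__measure_function_Measure
    _ _ _ _ _ (mrestr P mE) UV mUV.
pose nu : {measure set (R * R) -> \bar R} := mscale r nu0.
have nuE D : nu D = ((fine (P E))^-1%:E * P (UV @^-1` D `&` E))%E by [].
have invPE : ((fine (P E))^-1%:E * P E)%E = 1%E.
  by rewrite -[X in (_ * X)%E](fineK PEfin) -EFinM mulVf// lt0r_neq0.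
have -> : (distribution P U \x distribution P V)%E C = nu C.
  apply: product_measure_unique => // A1 A2 mA1 mA2.
  rewrite [LHS]nuE (_ : UV @^-1` _ `&` E = U @^-1` A1 `&` (V @^-1` A2 `&` E)).
    by rewrite h// muleCA (muleCA (_^-1)%:E) invPE mule1.
  by rewrite setIA.
by rewrite nuE muleAC invPE mul1e.
Qed.

(** The event [E] of the remaining functions factors off the joint law of [U] and [V], so it also
    factors off any function of the pair. *)
Lemma indep_seq_merge (op : R -> R -> R) U V L :
  measurable_fun [set: R * R] (fun p => op p.1 p.2) ->
  indep_seq (U :: V :: L) -> indep_seq ((fun w => op (U w) (V w)) :: L).
Proof.
move=> mop hUVL; have [/measurable_seq_cons[mU /measurable_seq_cons[mV mL]] h] := hUVL.
have mUV : measurable_fun [set: T] (fun w => op (U w) (V w)).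
  exact: (measurableT_comp mop (measurable_fun_pair mU mV)).
split => [|B mB]; first exact/measurable_seq_cons.
pose U' : {RV P >-> R} := HB.pack U (isMeasurableFun.Build _ _ _ _ U mU).
pose V' : {RV P >-> R} := HB.pack V (isMeasurableFun.Build _ _ _ _ V mV).
set E := joint_event L (B \o S).
have mE : measurable E by apply: measurable_joint_event => // k; exact: mB.
have PE : P E = prod_prob L (B \o S).
  by have [_] := indep_seq_tail _ _ (indep_seq_tail _ _ hUVL); apply => k; exact: mB.
have hE A1 A2 : measurable A1 -> measurable A2 ->
    P (U @^-1` A1 `&` (V @^-1` A2 `&` E)) =
    (P (U @^-1` A1) * (P (V @^-1` A2) * P E))%E.
  move=> mA1 mA2; rewrite PE.
  have := h (fun k => if k is k'.+1 then if k' is k''.+1 then B k''.+1 else A2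
                      else A1).
  by apply; case=> // -[].
pose C := (fun p : R * R => op p.1 p.2) @^-1` B 0%N.
have mC : measurable C by rewrite -[C]setTI; exact: mop.
have hUV := @indep_pair_law U' V'.
rewrite /= -/E -PE.
have -> : (fun w => op (U w) (V w)) @^-1` B 0%N =
  (fun w => (U' w, V' w)) @^-1` C by [].
rewrite (hUV E) //; congr (_ * _)%E.
(* Taking [setT] as the event identifies the product measure of [C] with the probability that the
   merged function lies in [B 0]. *)
rewrite -[X in P X]setIT (hUV setT) ?probability_setT ?mule1//.
move=> A1 A2 mA1 mA2.
have jT : joint_event L (fun=> setT) = setT.
  by elim: (L) => //= W L' ->; rewrite preimage_setT setTI.
have pT : prod_prob L (fun=> setT) = 1%E.
  by elim: (L) => //= W L' ->; rewrite preimage_setT probability_setT mule1.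
have := h (fun k => if k is k'.+1 then if k' is k''.+1 then setT else A2
                    else A1).
rewrite /= [joint_event _ _]jT [prod_prob _ _]pT.
by apply; case=> // -[].
Qed.

Lemma indep_seq_fold (idx : R) (op : Monoid.law idx) U L1 L2 :
  measurable_fun [set: R * R] (fun p => op p.1 p.2) ->
  indep_seq (U :: L1 ++ L2) ->
  indep_seq ((fun w => \big[op/idx]_(V <- U :: L1) V w) :: L2).
Proof.
move=> mop; elim: L1 U => [|V L1 IH] U /=.
  by under [in X in _ -> X]eq_fun do rewrite big_seq1.
move=> /indep_seq_merge -/(_ _ mop)/IH.
set F := fun _ => _; set G := fun _ => _; suff -> : F = G by [].
by apply/funext => w; rewrite /F /G !big_cons Monoid.mulmA.
Qed.

Lemma indep_seq_head_fold (idx : R) (op : Monoid.law idx) U L :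
  measurable_fun [set: R * R] (fun p => op p.1 p.2) ->
  indep_seq (U :: L) ->
  indep_seq [:: U; fun w => \big[op/idx]_(V <- L) V w].
Proof.
move=> mop; case: L => [|V L] h.
  under [X in [:: _; X]]eq_fun do rewrite big_nil.
  have [/measurable_seq_cons[mU _] hU] := h.
  split.
    do 2 (apply/measurable_seq_cons; split => //).
    by move=> k; rewrite nth_nil; exact: measurable_cst.
  move=> B mB /=; rewrite setIT mule1.
  have [B1|B1] := pselect (B 1%N idx).
    have -> : (fun=> idx) @^-1` B 1%N = [set: T] by apply/seteqP; split.
    by rewrite setIT probability_setT mule1.
  have -> : (fun=> idx) @^-1` B 1%N = @set0 T by apply/seteqP; split.
  by rewrite setI0 measure0 mule0.
apply: (indep_seq_rot_cat [:: _] [:: _]) => /=.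
by apply: indep_seq_fold; last by move: h => /indep_seq_rot; rewrite -cats1.
Qed.

(** Folding the first row leaves its sum at the head, which is rotated behind the remaining rows. A
    fold starts from a first entry, hence the nonempty rows. *)
Lemma indep_seq_row_sums (rows : seq (seq (T -> R))) :
  all (fun r => size r != 0%N) rows -> indep_seq (flatten rows) ->
  indep_seq [seq (fun w => \sum_(V <- r) V w) | r <- rows].
Proof.
rewrite -(cats0 (flatten rows)) -[X in _ -> _ -> indep_seq X](cat0s).
elim: rows [::] => [|[//|U r] rows IH] acc /=; first by rewrite cats0.
move=> hs; rewrite -catA => /indep_seq_fold.
have madd : measurable_fun [set: R * R] (fun p : R * R => p.1 + p.2).
  by exact: measurable_funD measurable_fst measurable_snd.
move=> /(_ 0 +%R madd)/indep_seq_rot; rewrite rcons_cat => /(IH _ hs).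
by rewrite cat_rcons.
Qed.

(** The joint law of the pair is the product of the two laws, so Tonelli's theorem separates the
    integrals. *)
Lemma expectation_indep_mul U V : (forall w, 0 <= U w) -> (forall w, 0 <= V w) ->
  indep_seq [:: U; V] ->
  (\int[P]_w (U w * V w)%:E = \int[P]_w (U w)%:E * \int[P]_w (V w)%:E)%E.
Proof.
move=> U0 V0 [/measurable_seq_cons[mU /measurable_seq_cons[mV _]] h].
pose U' : {RV P >-> R} := HB.pack U (isMeasurableFun.Build _ _ _ _ U mU).
pose V' : {RV P >-> R} := HB.pack V (isMeasurableFun.Build _ _ _ _ V mV).
have hE A1 A2 : measurable A1 -> measurable A2 ->
    P (U' @^-1` A1 `&` (V' @^-1` A2 `&` setT)) =
    (P (U' @^-1` A1) * (P (V' @^-1` A2) * P setT))%E.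
  move=> mA1 mA2; rewrite probability_setT.
  have := h (fun k => if k is k'.+1 then A2 else A1).
  by apply; case.
have law := indep_pair_law U' V' setT measurableT hE.
have mUV : measurable_fun [set: T] (fun w => (U' w, V' w)).
  exact: measurable_fun_pair.
(* Absolute values make the integrand nonnegative on the whole plane, as Tonelli requires, and
   change nothing at the values of [U] and [V]. *)
pose f (p : R * R) := (`|p.1| * `|p.2|)%:E.
have mf : measurable_fun [set: R * R] f.
  apply/measurable_EFinP/measurable_funM; apply: measurableT_comp => //.
have mabs : measurable_fun [set: R] (fun x : R => `|x|%:E).
  by apply/measurable_EFinP; exact: normr_measurable.
transitivity (\int[P]_w f (U' w, V' w))%E.
  by apply: eq_integral => w _; rewrite /f /= !ger0_norm.
transitivity (\int[pushforward P (fun w => (U' w, V' w))]_p f p)%E.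
  rewrite ge0_integral_pushforward//.
  by move=> x; rewrite /f lee_fin mulr_ge0.
transitivity (\int[distribution P U' \x distribution P V']_p f p)%E.
  apply: eq_measure_integral => A mA _; have := law A mA.
  by rewrite setIT probability_setT mule1; exact.
rewrite fubini_tonelli1 //; last by move=> p; rewrite /f lee_fin mulr_ge0.
transitivity (\int[distribution P U']_x (`|x|%:E * \int[distribution P V']_y `|y|%:E))%E.
  apply: eq_integral => x _; rewrite /fubini_F.
  under eq_integral do rewrite /f /= EFinM.
  by rewrite ge0_integralZl_EFin.
rewrite ge0_integralZr //; last exact: integral_ge0.
rewrite !ge0_integral_distribution//; congr (_ * _)%E;
  by apply: eq_integral => w _ /=; rewrite ger0_norm.
Qed.

Lemma expectation_indep_prod L : indep_seq L ->
  (forall k w, 0 <= nth (fun=> 0) L k w) ->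
  (\int[P]_w (\prod_(U <- L) U w)%:E = \prod_(U <- L) \int[P]_w (U w)%:E)%E.
Proof.
elim: L => [|U L IH] h L0.
  rewrite big_nil; under eq_integral do rewrite big_nil.
  by rewrite integral_cst// mul1e; exact: probability_setT.
rewrite big_cons -IH; last 2 first.
- exact: indep_seq_tail h.
- by move=> k; exact: (L0 k.+1).
have prod_ge0 w : 0 <= \prod_(V <- L) V w.
  rewrite (big_nth (fun=> 0)); apply: prodr_ge0 => k _; exact: (L0 k.+1).
rewrite -expectation_indep_mul //.
- by apply: eq_integral => w _; rewrite big_cons.
- exact: (L0 0%N).
apply: indep_seq_head_fold => //.
by apply: measurable_funM; [exact: measurable_fst|exact: measurable_snd].
Qed.

Lemma indep_seq_family (I : choiceType) (X : I -> {RV P >-> R}) (s : seq I) :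
  mutually_independent X -> uniq s -> indep_seq [seq (X k : T -> R) | k <- s].
Proof.
move=> hX us; split => [k|B mB].
  have [ks|ks] := ltnP k (size s); last first.
    by rewrite nth_default ?size_map//; exact: measurable_cst.
  case: s us ks => // i0 s us ks.
  by rewrite (nth_map i0).
(* Sets indexed by position become sets indexed by [I] through [index]; since [s] has no duplicates,
   each entry recovers its own position. *)
have := hX s (fun i => B (index i s)) us (fun k => mB _).
rewrite bigcap_seq.
move=> eqP1; transitivity (P (\big[setI/setT]_(i <- s) X i @^-1` B (index i s))).
  congr (P _); elim: s us B mB {eqP1} => [|i s IH] /=; first by move=> *; rewrite big_nil.
  move=> /andP[i_s us] B mB; rewrite big_cons /= eqxx; congr (_ `&` _).
  rewrite IH//; last by move=> k; exact: mB.
  apply: eq_big_seq => j js; case: ifP => [/eqP ij|//].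
  by move: i_s; rewrite ij js.
rewrite eqP1; elim: s us B mB {eqP1} => [|i s IH] /=; first by move=> *; rewrite big_nil.
move=> /andP[i_s us] B mB; rewrite big_cons /= eqxx; congr (_ * _)%E.
rewrite -IH//; last by move=> k; exact: mB.
apply: eq_big_seq => j js; case: ifP => [/eqP ij|//].
by move: i_s; rewrite ij js.
Qed.

End Independence.

Lemma same_law_integral d (T : measurableType d) d' (T' : measurableType d')
    (R : realType) (P : probability T R) (P' : probability T' R)
    (X : {RV P >-> R}) (Y : {RV P' >-> R}) (f : R -> R) :
  same_law X Y -> measurable_fun [set: R] f -> (forall x, 0 <= f x) ->
  (\int[P]_w (f (X w))%:E = \int[P']_w (f (Y w))%:E)%E.
Proof.
move=> XY mf f0.
have mEf : measurable_fun [set: measurableTypeR R] (EFin \o f) by exact/measurable_EFinP.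
rewrite -(ge0_integral_distribution X mEf) -?(ge0_integral_distribution Y mEf);
  try by move=> y; rewrite lee_fin.
by apply: eq_measure_integral => A mA _; exact: XY.
Qed.

(** * Exponential moments *)

Section RealFunctions.
Context {R : realType}.
Implicit Types (f g : R -> R).

Lemma is_derive_increment f (t l e : R) : 0 < e -> is_derive t 1 f l ->
  exists2 r : R, 0 < r &
    forall h, `|h| < r -> `|f (t + h) - f t - h * l| <= e * `|h|.
Proof.
move=> e0 [/cvg_ex[/= l' fl'] fl].
have ll' : l' = l by rewrite -fl; apply/esym/cvg_lim.
move: fl'; rewrite {}ll' => /cvgrPdist_le /(_ _ e0)[r /= r0 hr].
exists r => // h hlt; have [->|h0] := eqVneq h 0.
  by rewrite addr0 subrr mul0r subrr normr0 mulr0.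
have := hr h; rewrite /ball_ /= sub0r normrN => /(_ hlt h0).
rewrite scaler1 (addrC h t) => H.
have -> : f (t + h) - f t - h * l = - (h * (l - h^-1 *: (f (t + h) - f t))).
  rewrite mulrBr /GRing.scale /= mulrA mulfV// mul1r; ring.
by rewrite normrN normrM mulrC ler_wpM2r.
Qed.

Lemma is_derive_continuous f (t l : R) : is_derive t 1 f l -> {for t, continuous f}.
Proof.
move=> [df _]; apply: differentiable_continuous; exact/derivable1_diffP.
Qed.

(** The zero is the supremum of the points of [[a, b]] where [g] is negative, so such points
    accumulate at it from the left. *)
Lemma first_zero g (a b : R) : a <= b ->
  (forall x, a <= x <= b -> {for x, continuous g}) ->
  g a < 0 -> 0 < g b ->
  exists x0, [/\ a <= x0 < b, g x0 = 0 &
    forall e, 0 < e -> exists x, [/\ a <= x, x0 - e < x, x < x0 & g x < 0]].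
Proof.
move=> ab cg ga gb.
pose E := [set x | a <= x <= b /\ g x < 0].
have Ea : E a by rewrite /E /= lexx ab.
have ubE : ubound E b by move=> x [/andP[]].
have supE : has_sup E by split; [exists a | exists b].
set x0 := sup E.
have ax0 : a <= x0 by apply: ub_le_sup => //; exists b.
have x0b : x0 <= b by apply: ge_sup => //; exists a.
have cx0 : {for x0, continuous g} by apply: cg; rewrite ax0.
have near_x0 e : 0 < e -> exists x, [/\ a <= x, x0 - e < x, x <= x0 & g x < 0].
  move=> e0; have [x Ex x0x] := sup_adherent e0 supE; exists x.
  have [/andP[ax _] gx] := Ex.
  by split => //; apply: ub_le_sup => //; exists b.
have gx0_le : g x0 <= 0.
  rewrite leNgt; apply/negP => gx0.
  have [e /= e0 he] := cvgr_gt (g x0) cx0 0 gx0.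
  have [x [_ x1 x2 gx]] := near_x0 _ e0.
  have : 0 < g x by apply: he; rewrite /= ger0_norm ?subr_ge0//; lra.
  by rewrite ltNge ltW.
have x0_lt : x0 < b.
  by rewrite lt_neqAle x0b andbT; apply: contraTneq gx0_le => ->; rewrite -ltNge.
have gx0_ge : 0 <= g x0.
  rewrite leNgt; apply/negP => gx0.
  have [e /= e0 he] := cvgr_lt (g x0) cx0 0 gx0.
  pose h := Num.min (e / 2) (b - x0).
  have h0 : 0 < h by rewrite lt_min; apply/andP; split; lra.
  have [he2 hb] : h <= e / 2 /\ h <= b - x0 by rewrite !ge_min !lexx orbT.
  have : E (x0 + h).
    split; first by apply/andP; split; lra.
    apply: he; rewrite /= opprD addNKr normrN ger0_norm; lra.
  by move=> /(ub_le_sup (proj2 supE)); rewrite -/x0; lra.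
have gx0 : g x0 = 0 by apply/eqP; rewrite eq_le gx0_le.
exists x0; split => //; first by rewrite ax0.
move=> e e0; have [x [ax x1 x2 gx]] := near_x0 _ e0; exists x; split => //.
by rewrite lt_neqAle x2 andbT; apply: contraTneq gx => ->; rewrite gx0 ltxx.
Qed.

(* The derivative of [s |-> (c + phi s) / s] is negative somewhere in [(t, 1)]. *)
Lemma exists_small_legendre (phi m : R -> R) (c t : R) :
  (forall s : R, 0 < s -> is_derive s 1 phi (m s)) ->
  0 < t < 1 -> c + phi 1 < (c + phi t) / t ->
  exists2 s, 0 < s < 1 & s * m s - phi s < c.
Proof.
move=> dphi /andP[t0 t1] ht.
pose v s := (c + phi s) / s.
pose dv s := (m s * s - (c + phi s)) / s ^+ 2.
have dvE (s : R) : 0 < s -> is_derive s 1 v (dv s).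
  move=> s0; have s_neq0 : s != 0 by rewrite gt_eqF.
  have dc : is_derive s 1 (fun s => c + phi s) (m s).
    by have := is_deriveD (is_derive_cst c s 1) (dphi s s0); rewrite add0r.
  apply: is_derive_eq; first exact: (is_deriveM dc (is_deriveV s_neq0 (is_derive_id s 1))).
  by rewrite /dv /GRing.scale /=; field.
have [||s] := @MVT R v dv t 1 t1.
- by move=> s; rewrite in_itv /= => /andP[ts _]; apply: dvE; lra.
- apply: derivable_within_continuous => s; rewrite in_itv /= => /andP[ts _].
  by apply: ex_derive; apply: dvE; lra.
rewrite in_itv /= => /andP[ts s1] vE; have s0 : 0 < s by lra.
exists s; first by rewrite s0 s1.
have vlt : v 1 - v t < 0 by rewrite /v divr1 subr_lt0.
have : dv s < 0.
  have t1' : 0 < 1 - t by lra.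
  by rewrite -(pmulr_llt0 _ t1') -vE.
rewrite /dv pmulr_llt0 ?invr_gt0 ?exprn_gt0//; lra.
Qed.

(** The function [s * m s - phi s - c] is negative at [t0] and positive at 1. Just left of the zero
    [theta] there are tilts with Legendre value below [c], and continuity of [m] keeps their mean
    near [m theta]. *)
Lemma critical_point (phi m : R -> R) (c t0 : R) :
  (forall s : R, 0 < s -> is_derive s 1 phi (m s)) ->
  (forall s : R, 0 < s -> {for s, continuous m}) ->
  0 < t0 < 1 -> t0 * m t0 - phi t0 < c -> c < m 1 - phi 1 ->
  exists theta, [/\ 0 < theta < 1,
    c + phi theta = theta * m theta &
    forall e, 0 < e -> exists t, [/\ 0 < t,
      m theta - e < m t & t * m t - phi t < c]].
Proof.
move=> dphi cm /andP[t00 t01] ht0 c1.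
pose g t := t * m t - phi t - c.
have cg x : t0 <= x <= 1 -> {for x, continuous g}.
  move=> /andP[t0x _]; have x0 : 0 < x by lra.
  apply: cvgB; last exact: cvg_cst.
  apply: cvgB; last exact: is_derive_continuous (dphi x x0).
  by apply: cvgM; [exact: cvg_id|exact: cm].
have [||th [/andP[t0th th1] gth hth]] := first_zero g t0 1 (ltW t01) cg.
- by rewrite /g; lra.
- by rewrite /g; lra.
have th0 : 0 < th by lra.
exists th; split; first by rewrite th0.
  by move: gth; rewrite /g; lra.
move=> e e0.
have [r /= r0 hr] := cvgr_gt _ (cm th th0) (m th - e) (ltac:(lra)).
have [x [t0x x1 x2 gx]] := hth r r0.
exists x; split; first lra.
  by apply: hr; rewrite /= ger0_norm ?subr_ge0; lra.
by move: gx; rewrite /g; lra.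
Qed.

Lemma derive_right_lt f (t l x : R) : is_derive t 1 f l -> l < x ->
  exists2 s, 0 < s & f (t + s) - f t < s * x.
Proof.
move=> df tx.
have e0 : 0 < (x - l) / 2 by lra.
have [r r0 hr] := is_derive_increment _ _ _ _ e0 df.
have s0 : 0 < r / 2 by lra.
exists (r / 2) => //; have := hr (r / 2).
rewrite gtr0_norm// => /(_ ltac:(lra)); rewrite ler_norml => /andP[_].
have : 0 < r * (x - l) by apply: mulr_gt0; lra.
by set a := f (t + r / 2); set b := f t; nra.
Qed.

Lemma derive_left_lt f (t l x : R) : is_derive t 1 f l -> 0 < t -> x < l ->
  exists2 s, 0 < s < t & f (t - s) - f t < - s * x.
Proof.
move=> df t0 tx.
have e0 : 0 < (l - x) / 2 by lra.
have [r r0 hr] := is_derive_increment _ _ _ _ e0 df.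
pose s := Num.min (r / 2) (t / 2).
have s0 : 0 < s by rewrite lt_min; apply/andP; split; lra.
have [sr st] : s <= r / 2 /\ s <= t / 2 by rewrite !ge_min !lexx orbT.
exists s; first by apply/andP; split; lra.
have := hr (- s); rewrite normrN gtr0_norm// => /(_ ltac:(lra)).
rewrite ler_norml => /andP[_].
have : 0 < s * (l - x) by apply: mulr_gt0; lra.
by set a := f (t - s); set b := f t; nra.
Qed.

Lemma chernoff_rates (phi : R -> R) (t l x1 c : R) : is_derive t 1 phi l ->
  0 < t -> x1 < l -> t * l - phi t < c ->
  exists x2 l1 l2 r1 r2 r, [/\
    [/\ 0 <= l1, 0 <= l2, 0 <= t - l1 & 0 <= t + l2],
    [/\ 0 <= r1 <= r, 0 <= r2 <= r & r < 1],
    expR (l1 * x1) * expR (phi (t - l1)) = expR (phi t) * r1,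
    expR (- (l2 * x2)) * expR (phi (t + l2)) = expR (phi t) * r2 &
    expR (t * x2) = expR (phi t) * expR c].
Proof.
move=> dphi t0 x1l hc.
have [x2 x2E] : exists x2, t * x2 = c + phi t.
  by exists ((c + phi t) / t); rewrite mulrCA divff ?gt_eqF// mulr1.
have lx2 : l < x2 by rewrite -(ltr_pM2l t0) x2E; lra.
have [l2 l20 hl2] := derive_right_lt _ _ _ _ dphi lx2.
have [l1 /andP[l10 l1t] hl1] := derive_left_lt _ _ _ _ dphi t0 x1l.
pose r1 := expR (phi (t - l1) - phi t + l1 * x1).
pose r2 := expR (phi (t + l2) - phi t - l2 * x2).
exists x2, l1, l2, r1, r2, (Num.max r1 r2); split.
- by split; lra.
- have r1_lt : r1 < 1 by rewrite -expR0 ltr_expR; lra.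
  have r2_lt : r2 < 1 by rewrite -expR0 ltr_expR; lra.
  by rewrite !le_max !expR_ge0 !lexx orbT gt_max r1_lt r2_lt.
- by rewrite /r1 -!expRD; congr expR; lra.
- by rewrite /r2 -!expRD; congr expR; lra.
- by rewrite x2E -expRD addrC.
Qed.

End RealFunctions.

(** * The moment generating function and its derivatives *)

Section ExponentialMoments.
Context {R : realType} {d : measure_display} {T : measurableType d}
  {P : probability T R}.
Variable X : {RV P >-> R}.
Hypothesis X_cgf : forall t : R, 0 <= t -> cgf P X t \is a fin_num.

(** For [t > 0] this is the [k]-th derivative of the moment generating function. *)
Definition exp_moment (k : nat) (t : R) : R :=
  \int[P]_w (X w ^+ k * expR (t * X w)).

Let mX : measurable_fun [set: T] X. Proof. exact: measurable_funP. Qed.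

Let mexp t : measurable_fun [set: T] (fun w => expR (t * X w)).
Proof. by apply: measurableT_comp => //; exact: measurable_funM. Qed.

Let mpowexp k t : measurable_fun [set: T] (fun w => X w ^+ k * expR (t * X w)).
Proof. by apply: measurable_funM => //; exact: measurable_funX. Qed.

Lemma mmt_gen_funE t : 'M_P X t = (\int[P]_w (expR (t * X w))%:E)%E.
Proof.
rewrite /mmt_gen_fun unlock; apply: eq_integral => w _ /=.
by rewrite /GRing.mulr_fun mulrC.
Qed.

Lemma mmt_gen_fun_fin (t : R) : 0 <= t ->
  (0 < 'M_P X t)%E /\ 'M_P X t \is a fin_num.
Proof.
move=> /X_cgf; rewrite /cgf.
by case: ('M_P X t) => [r| |] //=; case: ifPn; rewrite -?ltNge// lte_fin.
Qed.

Lemma integrable_exp (t : R) : 0 <= t ->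
  P.-integrable [set: T] (EFin \o (fun w => expR (t * X w))).
Proof.
move=> /mmt_gen_fun_fin[_]; rewrite mmt_gen_funE => hfin.
apply/integrableP; split; first exact/measurable_EFinP.
under eq_integral do rewrite /= ger0_norm ?expR_ge0//.
by rewrite -ge0_fin_numE ?integral_ge0// => w _; rewrite lee_fin expR_ge0.
Qed.

Lemma pow_le_fact_expR (x : R) k : 0 <= x -> x ^+ k <= k`!%:R * expR x.
Proof.
move=> x0; case: k => [|k]; first by rewrite expr0 mul1r -expR0 ler_expR.
have k0 : 0 < (k.+1)`!%:R :> R by rewrite ltr0n fact_gt0.
rewrite mulrC -ler_pdivrMr//; apply: le_trans (expR_ge1Dxn k x0).
by rewrite lerDr.
Qed.

(** A bound uniform in [s] for domination: for [x >= 0] the power is absorbed by raising the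
    exponent by one, and for [x < 0] the decay of [expR (a * x)] leaves a constant, so no
    exponential moment at a negative argument is involved. *)
Lemma pow_expR_le (a b s x : R) k : 0 < a -> a <= s -> s <= b ->
  `|x ^+ k * expR (s * x)| <=
  k`!%:R / a ^+ k + k`!%:R * expR ((b + 1) * x).
Proof.
move=> a0 a_s sb; rewrite normrM (ger0_norm (expR_ge0 _)) normrX.
have [x0|x0] := leP 0 x.
  rewrite ger0_norm//.
  apply: (@le_trans _ _ (k`!%:R * expR ((b + 1) * x))); last first.
    by rewrite lerDr divr_ge0// exprn_ge0// ltW.
  apply: le_trans (ler_wpM2r (expR_ge0 _) (pow_le_fact_expR _ k x0)) _.
  rewrite -mulrA -expRD ler_wpM2l// ler_expR mulrDl mul1r addrC lerD2r.
  by rewrite ler_wpM2r.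
apply: (@le_trans _ _ (k`!%:R / a ^+ k)); last first.
  by rewrite lerDl mulr_ge0// expR_ge0.
have ax0 : 0 <= a * `|x| by rewrite mulr_ge0// ltW.
rewrite ler_pdivlMr ?exprn_gt0//.
have -> : `|x| ^+ k * expR (s * x) * a ^+ k = (a * `|x|) ^+ k * expR (s * x).
  by rewrite exprMn; ring.
apply: le_trans (ler_wpM2r (expR_ge0 _) (pow_le_fact_expR _ k ax0)) _.
rewrite -mulrA -expRD ler_piMr// -expR0 ler_expR ltr0_norm//.
by rewrite mulrN addrC -mulrBl nmulr_lle0// subr_ge0.
Qed.

Lemma integrable_dominating (C1 C2 t : R) : 0 <= t ->
  P.-integrable [set: T] (EFin \o (fun w => C1 + C2 * expR (t * X w))).
Proof.
move=> t0; rewrite /comp; under eq_fun do rewrite EFinD EFinM.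
apply: integrableD => //.
- exact: finite_measure_integrable_cst.
- by apply: integrableZl => //; exact: integrable_exp.
Qed.

Lemma integrable_pow_exp (k : nat) (t : R) : 0 < t ->
  P.-integrable [set: T] (EFin \o (fun w => X w ^+ k * expR (t * X w))).
Proof.
move=> t0.
apply: (le_integrable measurableT _ _ (integrable_dominating
  (k`!%:R / t ^+ k) k`!%:R (t + 1) _)).
- exact/measurable_EFinP.
- move=> w _; rewrite lee_fin; apply: (le_trans (pow_expR_le t t t _ k t0 _ _)) => //.
  exact: ler_norm.
- by rewrite addr_ge0 ?ltW.
Qed.

Lemma is_derive_pow_exp k (x t : R) :
  is_derive t 1 (fun s => x ^+ k * expR (s * x)) (x ^+ k.+1 * expR (t * x)).
Proof.
apply: is_derive_eq.
by rewrite scaler0 add0r /GRing.scale /= mulr1 exprSr; ring.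
Qed.

Lemma is_derive_exp_moment (k : nat) (t : R) : 0 < t ->
  is_derive t 1 (exp_moment k) (exp_moment k.+1 t).
Proof.
move=> t0.
pose f s w := X w ^+ k * expR (s * X w).
have d1E s w : partial1of2 f s w = X w ^+ k.+1 * expR (s * X w).
  by rewrite partial1of2E; apply: derive_val; exact: is_derive_pow_exp.
have tI : `](t / 2), (t + 1)[%classic t.
  by rewrite /= in_itv /=; apply/andP; split; lra.
(* The dominating function is the bound of [pow_expR_le] with [a = t / 2] and [b = t + 1], the ends
   of the interval of differentiation. *)
pose G w := k.+1`!%:R / (t / 2) ^+ k.+1 + k.+1`!%:R * expR ((t + 1 + 1) * X w).
have G0 w : 0 <= G w.
  by rewrite addr_ge0// ?mulr_ge0 ?expR_ge0// invr_ge0 exprn_ge0//; lra.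
have intf s : `](t / 2), (t + 1)[%classic s ->
    P.-integrable [set: T] (EFin \o f s).
  by rewrite /= in_itv /= => /andP[ts _]; apply: integrable_pow_exp; lra.
have df s w : `](t / 2), (t + 1)[%classic s -> setT w -> derivable (f ^~ w) s 1.
  by move=> _ _; apply: ex_derive; exact: is_derive_pow_exp.
have intG : P.-integrable [set: T] (EFin \o G).
  by apply: integrable_dominating; lra.
have dG s w : `](t / 2), (t + 1)[%classic s -> setT w -> `|partial1of2 f s w| <= G w.
  rewrite /= in_itv /= => /andP[ts st] _; rewrite d1E.
  by apply: pow_expR_le; lra.
apply: DeriveDef.
  exact: (derivable_under_integral measurableT tI intf df G0 intG dG).
rewrite -derive1E (differentiation_under_integral measurableT tI intf df G0 intG dG).
by apply: eq_Rintegral => w _; rewrite d1E.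
Qed.

Lemma exp_moment0E (t : R) : 0 <= t ->
  (\int[P]_w (expR (t * X w))%:E = (exp_moment 0 t)%:E)%E.
Proof.
move=> t0; have [_] := mmt_gen_fun_fin t t0; rewrite mmt_gen_funE => /fineK <-.
rewrite /exp_moment /Rintegral; congr (fine _)%:E.
by apply: eq_integral => w _; rewrite expr0 mul1r.
Qed.

Lemma exp_moment0_gt0 (t : R) : 0 <= t -> 0 < exp_moment 0 t.
Proof.
move=> t0; have [+ _] := mmt_gen_fun_fin t t0.
by rewrite mmt_gen_funE exp_moment0E.
Qed.

Definition log_mgf (t : R) : R := ln (exp_moment 0 t).

(** The mean of [X] under the law with density proportional to [expR (t * X)], which for [t > 0] is
    also the derivative of [log_mgf]. *)
Definition tilted_mean (t : R) : R := exp_moment 1 t / exp_moment 0 t.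

Lemma fine_cgf (t : R) : 0 <= t -> fine (cgf P X t) = log_mgf t.
Proof.
by move=> t0; rewrite /cgf mmt_gen_funE exp_moment0E// lne_EFin ?exp_moment0_gt0.
Qed.

Lemma is_derive_log_mgf (t : R) : 0 < t -> is_derive t 1 log_mgf (tilted_mean t).
Proof.
move=> t0; have M0 := exp_moment0_gt0 t (ltW t0).
rewrite /tilted_mean mulrC.
exact: (is_derive1_comp (is_derive1_ln M0) (is_derive_exp_moment 0 t t0)).
Qed.

Lemma critical_rateE : critical_rate P X = tilted_mean 1 - log_mgf 1.
Proof.
rewrite /critical_rate fine_cgf// derive1E; congr (_ - _).
rewrite (@near_eq_derive _ _ _ _ log_mgf).
  by apply: derive_val; exact: is_derive_log_mgf.
exists 1 => //= t /=; rewrite /ball_ /= ltr_distlC => /andP[t0 _].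
by rewrite /= fine_cgf//; lra.
Qed.

Lemma continuous_tilted_mean (t : R) : 0 < t -> {for t, continuous tilted_mean}.
Proof.
move=> t0; apply: cvgM.
  exact: is_derive_continuous (is_derive_exp_moment 1 t t0).
apply: cvgV; first by rewrite gt_eqF// exp_moment0_gt0// ltW.
exact: is_derive_continuous (is_derive_exp_moment 0 t t0).
Qed.

(** Since [X > - K] has probability at least [expR (- b)] for large [K], restricting the expectation
    to this event gives a bound with the same [K] for all [t >= 0]. *)
Lemma log_mgf_ge (b : R) : 0 < b ->
  exists2 K, 0 < K & forall t, 0 <= t -> - (t * K) - b <= log_mgf t.
Proof.
move=> b0; have eb1 : expR (- b) < 1 by rewrite -expR0 ltr_expR oppr_lt0.
have /fine_cvgP[ccfin cc1] := @cvg_ccdfNy1 _ _ _ P X.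
(* Below [A] the tail function is finite and below [B] it exceeds [expR (- b)]; [- K] is chosen
   below both. *)
have [K K0 hK] : exists2 K, 0 < K & ((expR (- b))%:E <= ccdf X (- K))%E.
  have [A [_ hA]] := ccfin; have [B [_ hB]] := cvgr_gt _ cc1 _ eb1.
  exists (1 + `|A| + `|B|); first by rewrite -addrA ltr_pwDl// addr_ge0.
  have ltA : - (1 + `|A| + `|B|) < A.
    by have := ler_norm (- A); have := normr_ge0 B; rewrite normrN; lra.
  have ltB : - (1 + `|A| + `|B|) < B.
    by have := ler_norm (- B); have := normr_ge0 A; rewrite normrN; lra.
  by rewrite -(fineK (hA _ ltA)) lee_fin ltW// hB.
exists K => // t t0.
rewrite -ler_expR lnK ?posrE ?exp_moment0_gt0// -lee_fin -exp_moment0E//.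
pose A := X @^-1` `]- K, +oo[.
have mA : measurable A by apply: measurable_preimage.
apply: (@le_trans _ _ (\int[P]_w (expR (- (t * K)) * \1_A w)%:E)%E).
  under eq_integral do rewrite EFinM.
  rewrite ge0_integralZl_EFin ?expR_ge0//.
    rewrite integral_indic// setIT -mulrN expRD EFinM mulrN.
    by apply: lee_pmul => //; rewrite lee_fin expR_ge0.
  exact/measurable_EFinP/measurable_indic.
apply: ge0_le_integral => //.
- by apply/measurable_EFinP/measurable_funM => //; exact: measurable_indic.
- exact/measurable_EFinP.
move=> w _; rewrite lee_fin indicE.
case: (boolP (w \in A)) => /=; rewrite ?mulr0 ?expR_ge0// mulr1.
rewrite inE /A /= in_itv /= andbT => Kw; rewrite ler_expR -mulrN.
by rewrite ler_wpM2l// ltW.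
Qed.

(** By [log_mgf_ge] with [b = c / 2] the numerator is at least [c / 2 - t * K], so the quotient is
    unbounded as [t] tends to 0. The constant [D] exceeds [K + c + log_mgf 1], and [t] is small
    enough for [t * D <= c / 2]. *)
Lemma log_mgf_lower (c : R) : 0 < c ->
  exists2 t, 0 < t < 1 & c + log_mgf 1 < (c + log_mgf t) / t.
Proof.
move=> c0; have [|K K0] := log_mgf_ge (c / 2); first by lra.
have := ler_norm (log_mgf 1); have := normr_ge0 (log_mgf 1).
move: (log_mgf) => phi; move: `|phi 1| => a a0 phia hphi.
pose D := K + c + a + 1.
have D0 : 0 < D by rewrite /D; lra.
have q0 : 0 < c / (2 * D) by apply: divr_gt0; lra.
pose t := Num.min 2^-1 (c / (2 * D)).
have t0 : 0 < t by rewrite lt_min q0 andbT; lra.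
have [t2 tq] : t <= 2^-1 /\ t <= c / (2 * D) by rewrite !ge_min !lexx orbT.
have tD : t * D <= c / 2.
  have -> : c / 2 = c / (2 * D) * D by field; rewrite gt_eqF.
  by rewrite ler_wpM2r// ltW.
exists t; first by rewrite t0; lra.
rewrite ltr_pdivlMr//.
have := hphi t (ltW t0).
have : t * (c + phi 1) <= t * (D - 1 - K) by rewrite ler_wpM2l//; [lra|rewrite /D; lra].
by nra.
Qed.

Lemma critical_tilt (c : R) : 0 < c -> c < critical_rate P X ->
  exists theta, [/\ 0 < theta < 1,
    c + log_mgf theta = theta * tilted_mean theta &
    forall e, 0 < e -> exists t, [/\ 0 < t,
      tilted_mean theta - e < tilted_mean t &
      t * tilted_mean t - log_mgf t < c]].
Proof.
move=> c0; rewrite critical_rateE => c1.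
have [t t01 ht] := log_mgf_lower c c0.
have [t0 t001 ht0] := exists_small_legendre _ _ _ _ is_derive_log_mgf t01 ht.
exact: critical_point is_derive_log_mgf continuous_tilted_mean t001 ht0 c1.
Qed.

End ExponentialMoments.

(** * Expectations of nonnegative variables *)

(** Recording the mean as a real number, together with measurability and sign, lets later estimates
    be carried out in [R] instead of the extended reals. *)
Definition has_mean {R : realType} {d : measure_display} {T : measurableType d}
    (P : probability T R) (f : T -> R) (a : R) : Prop :=
  [/\ measurable_fun [set: T] f, (forall w, 0 <= f w) &
    (\int[P]_w (f w)%:E = a%:E)%E].

Section HasMean.
Context {R : realType} {d : measure_display} {T : measurableType d}
  {P : probability T R}.
Implicit Types (f g : T -> R) (a b k : R).

Lemma has_mean_measurable f a : has_mean P f a -> measurable_fun [set: T] f.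
Proof. by case. Qed.

Lemma has_mean_ge0 f a : has_mean P f a -> 0 <= a.
Proof.
by move=> [_ f0 fa]; rewrite -lee_fin -fa; apply: integral_ge0 => w _; rewrite lee_fin.
Qed.

Lemma eq_has_mean f g a : f =1 g -> has_mean P f a -> has_mean P g a.
Proof. by move=> /funext->. Qed.

Lemma has_meanD f g a b : has_mean P f a -> has_mean P g b ->
  has_mean P (fun w => f w + g w) (a + b).
Proof.
move=> [mf f0 fa] [mg g0 gb]; split.
- exact: measurable_funD.
- by move=> w; rewrite addr_ge0.
under eq_integral do rewrite EFinD.
rewrite ge0_integralD//; first by rewrite fa gb.
- by move=> w _; rewrite lee_fin.
- exact/measurable_EFinP.
- by move=> w _; rewrite lee_fin.
- exact/measurable_EFinP.
Qed.

Lemma has_meanZ f a k : 0 <= k -> has_mean P f a ->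
  has_mean P (fun w => k * f w) (k * a).
Proof.
move=> k0 [mf f0 fa]; split.
- exact: measurable_funM.
- by move=> w; rewrite mulr_ge0.
under eq_integral do rewrite EFinM.
rewrite ge0_integralZl_EFin//; first by rewrite fa.
- by move=> w _; rewrite lee_fin.
- exact/measurable_EFinP.
Qed.

Lemma has_mean_cst k : 0 <= k -> has_mean P (fun=> k) k.
Proof.
move=> k0; split=> //.
by rewrite integral_cst// [X in (_ * X)%E]probability_setT mule1.
Qed.

Lemma has_mean_le f g a b : has_mean P f a -> has_mean P g b ->
  (forall w, f w <= g w) -> a <= b.
Proof.
move=> [mf f0 fa] [mg g0 gb] fg; rewrite -lee_fin -fa -gb.
apply: ge0_le_integral => //; [by move=> w _; rewrite lee_fin | exact/measurable_EFinP..|].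
by move=> w _; rewrite lee_fin.
Qed.

Lemma has_mean_dominated f g b : measurable_fun [set: T] f ->
  (forall w, 0 <= f w <= g w) -> has_mean P g b ->
  exists2 a, has_mean P f a & a <= b.
Proof.
move=> mf fg gb; have f0 w : 0 <= f w by have /andP[] := fg w.
have fg' w : f w <= g w by have /andP[] := fg w.
have [mg g0 gE] := gb.
pose a := fine (\int[P]_w (f w)%:E)%E.
have fa : has_mean P f a.
  split => //; rewrite fineK// ge0_fin_numE; last first.
    by apply: integral_ge0 => w _; rewrite lee_fin.
  apply: le_lt_trans (ltry b); rewrite -gE.
  apply: ge0_le_integral => //; [by move=> w _; rewrite lee_fin | exact/measurable_EFinP..|].
  by move=> w _; rewrite lee_fin.
exists a => //; exact: has_mean_le fa gb fg'.
Qed.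

Lemma has_mean_prob (A : T -> bool) : measurable_fun [set: T] A ->
  has_mean P (fun w => if A w then 1 else 0) (fine (P [set w | A w])).
Proof.
move=> mA.
have mA' : measurable [set w | A w].
  by rewrite -[X in measurable X]setTI; exact: (mA measurableT [set true]).
split.
- exact: measurable_fun_ifT.
- by move=> w; case: ifP.
rewrite fineK ?fin_num_measure// -[X in _ = P X]setIT -integral_indic//.
apply: eq_integral => w _; rewrite indicE; congr (_%:E).
by case: (boolP (A w)) => Aw; [rewrite mem_set|rewrite memNset//; exact/negP].
Qed.

Lemma has_mean_mul_indep f g a b : indep_seq [:: f; g] (P := P) ->
  has_mean P f a -> has_mean P g b -> has_mean P (fun w => f w * g w) (a * b).
Proof.
move=> fg [mf f0 fa] [mg g0 gb]; split.
- exact: measurable_funM.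
- by move=> w; rewrite mulr_ge0.
by rewrite expectation_indep_mul// fa gb.
Qed.

End HasMean.

(** * Row sums and the exchange inequality *)

(** From [1 - l <= expR (- l)] follows [expR l * (1 - l) <= 1], while the right side times [1 - l]
    equals [1 + l ^+ 2 * (1 - 2 * l)], which is at least 1. *)
Lemma expR_le_quadratic {R : realType} (l : R) : - 2^-1 <= l <= 2^-1 ->
  expR l <= 1 + l + 2 * l ^+ 2.
Proof.
move=> hl; have l1 : 0 < 1 - l by lra.
have h : 1 - l <= expR (- l) by exact: expR_ge1Dx.
have h1 : expR l * (1 - l) <= 1.
  by apply: le_trans (ler_wpM2l (expR_ge0 l) h) _; rewrite expRxMexpNx_1.
rewrite -(ler_pM2r l1); apply: le_trans h1 _.
have := sqr_ge0 l; rewrite expr2 => l2.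
have : 0 <= l * l * (1 - 2 * l) by rewrite mulr_ge0//; lra.
lra.
Qed.

Section RowSums.
Context {R : realType} {d0 : measure_display} {T0 : measurableType d0}
  {P0 : probability T0 R} (X0 : {RV P0 >-> R})
  {d : measure_display} {T : measurableType d} {P : probability T R}
  {I : choiceType} (X : I -> {RV P >-> R}).
Hypothesis X_copies : independent_copies X X0.
Variable s : seq I.
Hypothesis s_uniq : uniq s.
Implicit Types (f g : R -> R) (k : I) (a b z theta : R).

Definition row_sum (w : T) : R := \sum_(k <- s) X k w.

Lemma measurable_row_sum : measurable_fun [set: T] row_sum.
Proof. by apply: measurable_sum => k; exact: measurable_funP. Qed.

Lemma measurable_comp_rv k f : measurable_fun [set: R] f ->
  measurable_fun [set: T] (f \o X k).
Proof. by move=> mf; apply: measurableT_comp => //; exact: measurable_funP. Qed.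

Lemma has_mean_copy k f a : measurable_fun [set: R] f -> (forall x, 0 <= f x) ->
  has_mean P0 (f \o X0) a -> has_mean P (f \o X k) a.
Proof.
move=> mf f0 [_ _ fa]; split; first exact: measurable_comp_rv.
  by move=> w; exact: f0.
by rewrite -fa; apply: same_law_integral => //; exact: X_copies.2.
Qed.

Lemma has_mean_row_prod f a : measurable_fun [set: R] f -> (forall x, 0 <= f x) ->
  has_mean P0 (f \o X0) a ->
  has_mean P (fun w => \prod_(k <- s) f (X k w)) (a ^+ size s).
Proof.
move=> mf f0 fa; split.
- by apply: measurable_prod => k _; exact: measurable_comp_rv.
- by move=> w; apply: prodr_ge0.
have hi : indep_seq [seq f \o U | U <- [seq (X k : T -> R) | k <- s]] (P := P).
  by apply: indep_seq_map => //; apply: indep_seq_family => //; exact: X_copies.1.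
rewrite -map_comp in hi.
have hE := expectation_indep_prod _ hi.
transitivity (\prod_(k <- s) \int[P]_w ((f \o X k) w)%:E)%E.
  move: hE; rewrite big_map => <-.
    by apply: eq_integral => w _; rewrite big_map.
  move=> j w; have [js|js] := ltnP j (size s); last by rewrite nth_default ?size_map.
  by case: (s) js => // k0 t js; rewrite (nth_map k0)//=.
elim: (s) => [|k t IH]; first by rewrite big_nil.
rewrite big_cons IH exprS EFinM; congr (_ * _)%E.
by have [] := has_mean_copy k f a mf f0 fa.
Qed.

Lemma expR_row_sum g w : expR (\sum_(k <- s) g (X k w)) =
  \prod_(k <- s) expR (g (X k w)).
Proof. by rewrite expR_sum. Qed.

Lemma measurable_row_fun g : measurable_fun [set: R] g ->
  measurable_fun [set: T] (fun w => \sum_(k <- s) g (X k w)).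
Proof. by move=> mg; apply: measurable_sum => k; exact: measurable_comp_rv. Qed.

Lemma has_mean_exp_row_sum theta M :
  has_mean P0 (fun w => expR (theta * X0 w)) M ->
  has_mean P (fun w => expR (theta * row_sum w)) (M ^+ size s).
Proof.
move=> hM; apply: (eq_has_mean (fun w => \prod_(k <- s) expR (theta * X k w))).
  by move=> w; rewrite -(expR_row_sum (fun x => theta * x)) -mulr_sumr.
apply: (has_mean_row_prod (fun x => expR (theta * x))) hM => [|x].
- by apply: measurableT_comp => //; exact: measurable_funM.
- exact: expR_ge0.
Qed.

Lemma measurable_ler_row g b : measurable_fun [set: R] g ->
  measurable_fun [set: T] (fun w => b <= \sum_(k <- s) g (X k w)).
Proof. by move=> mg; apply: measurable_fun_ler => //; exact: measurable_row_fun. Qed.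

(** Markov's inequality under the unnormalised [theta]-tilted law: the indicator is at most the
    exponential of the sum of [g] minus [b], and the resulting product has mean [a ^+ size s]. *)
Lemma row_chernoff theta g b a : measurable_fun [set: R] g ->
  has_mean P0 (fun w => expR (theta * X0 w + g (X0 w))) a ->
  exists2 e, has_mean P (fun w => if b <= \sum_(k <- s) g (X k w)
      then expR (theta * row_sum w) else 0) e &
    e <= expR (- b) * a ^+ size s.
Proof.
move=> mg ha.
have mtg : measurable_fun [set: R] (fun x => theta * x + g x).
  by apply: measurable_funD => //; exact: measurable_funM.
have hprod : has_mean P (fun w => \prod_(k <- s) expR (theta * X k w + g (X k w)))
    (a ^+ size s).
  apply: (has_mean_row_prod (fun x => expR (theta * x + g x))) ha => [|x].
  - exact: measurableT_comp.
  - exact: expR_ge0.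
apply: (has_mean_dominated _ _ _ _ _ (has_meanZ _ _ _ (expR_ge0 (- b)) hprod)).
  apply: measurable_fun_ifT => //; first exact: measurable_ler_row.
  apply: measurableT_comp => //; apply: measurable_funM => //.
  exact: measurable_row_sum.
move=> w; rewrite -(expR_row_sum (fun x => theta * x + g x)) -expRD.
case: ifPn => [hb|_]; last by rewrite lexx expR_ge0.
rewrite expR_ge0 /= ler_expR.
by rewrite big_split /= -mulr_sumr; rewrite /row_sum; lra.
Qed.


(** * Exchanging one summand between two intervals *)

Section Raise.
Variables (theta u1 u2 v1 v2 qA qB : R).
Hypothesis theta1 : theta <= 1.
Hypothesis hqA : has_mean P0
  (fun w => if u1 <= X0 w <= u2 then expR (theta * X0 w) else 0) qA.
Hypothesis hqB : has_mean P0
  (fun w => if v1 <= X0 w <= v2 then expR (theta * X0 w) else 0) qB.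

Definition trunc_exp z (w : T) : R :=
  if row_sum w <= z then expR (row_sum w) else 0.

Lemma measurable_trunc_exp z : measurable_fun [set: T] (trunc_exp z).
Proof.
apply: measurable_fun_ifT => //.
- by apply: measurable_fun_ler => //; exact: measurable_row_sum.
- by apply: measurableT_comp => //; exact: measurable_row_sum.
Qed.

Lemma trunc_exp_bounds z w : 0 <= trunc_exp z w <= expR z.
Proof.
rewrite /trunc_exp; case: ifPn => [hz|_]; last by rewrite lexx expR_ge0.
by rewrite expR_ge0 ler_expR.
Qed.

Lemma measurable_between (f : T -> R) a b : measurable_fun [set: T] f ->
  measurable_fun [set: T] (fun w => a <= f w <= b).
Proof.
by move=> mf; apply: measurable_and; apply: measurable_fun_ler.
Qed.

Definition trunc_exp_on a b z k (w : T) : R :=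
  if a <= X k w <= b then trunc_exp z w else 0.

Lemma measurable_trunc_exp_on a b z k :
  measurable_fun [set: T] (trunc_exp_on a b z k).
Proof.
apply: measurable_fun_ifT => //; last exact: measurable_trunc_exp.
by apply: measurable_between; exact: measurable_funP.
Qed.

Lemma has_mean_trunc_exp_on a b z k :
  exists2 e, has_mean P (trunc_exp_on a b z k) e & e <= expR z.
Proof.
apply: (has_mean_dominated _ _ _ _ _ (has_mean_cst _ (expR_ge0 z))).
  exact: measurable_trunc_exp_on.
move=> w; rewrite /trunc_exp_on; case: ifPn => _; last by rewrite lexx expR_ge0.
exact: trunc_exp_bounds.
Qed.

(* Exchanging a summand from [u1, u2] for one from [v1, v2] keeps the row sum
   below [z] and multiplies the exponential by at least [exp (v1 - u2)]. *)
Lemma raise_one z k a b : k \in s ->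
  has_mean P (trunc_exp_on u1 u2 (z - (v2 - u1)) k) a ->
  has_mean P (trunc_exp_on v1 v2 z k) b ->
  a * qB <= expR (- ((1 - theta) * (v1 - u2))) * qA * b.
Proof.
move=> ks ha hb.
pose rest w := \sum_(j <- rem k s) X j w.
have sumE w : row_sum w = X k w + rest w by rewrite /row_sum (big_rem k).
pose fA x := if u1 <= x <= u2 then expR (theta * x) else 0.
pose fB x := if v1 <= x <= v2 then expR (theta * x) else 0.
(* This threshold serves both sides: a summand at least [u1] with row sum at most [z - (v2 - u1)]
   forces [rest <= z - v2], and [rest <= z - v2] with a summand at most [v2] gives a row sum at most
   [z]. *)
pose g r := if r <= z - v2 then expR r else 0.
have mexp c : measurable_fun [set: R] (fun x => expR (c * x)).
  by apply: measurableT_comp => //; exact: measurable_funM.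
have mbetw (c e : R) : measurable_fun [set: R] (fun x : R => c <= x <= e).
  by apply: measurable_and; apply: measurable_fun_ler.
have mfA : measurable_fun [set: R] fA by apply: measurable_fun_ifT.
have mfB : measurable_fun [set: R] fB by apply: measurable_fun_ifT.
have mg : measurable_fun [set: R] g.
  by apply: measurable_fun_ifT => //; apply: measurable_fun_ler.
have fA0 x : 0 <= fA x by rewrite /fA; case: ifP; rewrite ?expR_ge0.
have fB0 x : 0 <= fB x by rewrite /fB; case: ifP; rewrite ?expR_ge0.
have mrest : measurable_fun [set: T] rest.
  by apply: measurable_sum => j; exact: measurable_funP.
have [c hc _] : exists2 c, has_mean P (g \o rest) c & c <= expR (z - v2).
  apply: (has_mean_dominated _ _ _ _ _ (has_mean_cst _ (expR_ge0 _))).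
    exact: measurableT_comp.
  move=> w; rewrite /g /=; case: ifPn => [hz|_]; last by rewrite lexx expR_ge0.
  by rewrite expR_ge0 ler_expR.
have c0 := has_mean_ge0 _ _ hc.
have hind : indep_seq [:: (X k : T -> R); rest] (P := P).
  have uk : uniq (k :: rem k s) by rewrite /= mem_rem_uniqF// rem_uniq.
  have := indep_seq_family I X (k :: rem k s) X_copies.1 uk.
  move=> /(indep_seq_head_fold 0 +%R).
  have madd : measurable_fun [set: R * R] (fun p : R * R => p.1 + p.2).
    exact: measurable_funD measurable_fst measurable_snd.
  move=> /(_ madd); congr indep_seq; congr [:: _; _].
  by apply/funext => w; rewrite big_map.
have hindf f : measurable_fun [set: R] f -> indep_seq [:: f \o X k; g \o rest] (P := P).
  move=> mf; have := indep_seq_comp f _ _ mf hind.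
  move=> /indep_seq_rot /(indep_seq_comp g _ _ mg) /indep_seq_rot.
  exact.
have hA := has_mean_mul_indep _ _ _ _ (hindf fA mfA)
  (has_mean_copy k fA qA mfA fA0 hqA) hc.
have hB := has_mean_mul_indep _ _ _ _ (hindf fB mfB)
  (has_mean_copy k fB qB mfB fB0 hqB) hc.
(* The factor [expR x] of the exchanged summand is [expR (theta * x)] times
   [expR ((1 - theta) * x)]; the latter is at most its value at [u2] here and at least its value at
   [v1] in [bB]. *)
have aA : a <= expR ((1 - theta) * u2) * (qA * c).
  apply: (has_mean_le _ _ _ _ ha (has_meanZ _ _ _ (expR_ge0 _) hA)) => w.
  rewrite /trunc_exp_on /trunc_exp /fA /g /= sumE.
  case: ifPn => [/andP[ux xu]|_]; last by rewrite mul0r mulr0.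
  case: ifPn => [xz|_]; last by rewrite !mulr_ge0 ?expR_ge0//; case: ifP; rewrite ?expR_ge0.
  rewrite ifT; last by lra.
  rewrite -!expRD ler_expR.
  have : 0 <= (1 - theta) * (u2 - X k w) by rewrite mulr_ge0 ?subr_ge0.
  by move: (X k w) (rest w) => x r; lra.
have bB : expR ((1 - theta) * v1) * (qB * c) <= b.
  apply: (has_mean_le _ _ _ _ (has_meanZ _ _ _ (expR_ge0 _) hB) hb) => w.
  rewrite /trunc_exp_on /trunc_exp /fB /g /= sumE.
  case: ifPn => [/andP[vx xv]|_]; last by rewrite mul0r mulr0.
  case: ifPn => [rz|_]; last first.
    by rewrite !mulr0; case: ifP; rewrite ?expR_ge0.
  rewrite ifT; last by lra.
  rewrite -!expRD ler_expR.
  have : 0 <= (1 - theta) * (X k w - v1) by rewrite mulr_ge0 ?subr_ge0.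
  by move: (X k w) (rest w) => x r; lra.
have qA0 := has_mean_ge0 _ _ hqA; have qB0 := has_mean_ge0 _ _ hqB.
apply: (le_trans (ler_wpM2r qB0 aA)).
have := ler_wpM2l (mulr_ge0 (expR_ge0 (- ((1 - theta) * (v1 - u2)))) qA0) bB.
apply: le_trans; rewrite le_eqVlt; apply/orP; left; apply/eqP.
have -> : expR ((1 - theta) * u2) =
    expR (- ((1 - theta) * (v1 - u2))) * expR ((1 - theta) * v1).
  by rewrite -expRD; congr expR; lra.
ring.
Qed.

End Raise.

(** * The number of summands in an interval under the tilted law *)

Definition row_count a b (w : T) : R :=
  \sum_(k <- s) (if a <= X k w <= b then 1 else 0).

Lemma row_count_bounds a b w : 0 <= row_count a b w <= (size s)%:R.
Proof.
rewrite /row_count; elim: (s) => [|k t /andP[IH0 IH1]]; first by rewrite big_nil lexx.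
by rewrite big_cons -natr1 /=; case: ifP => _; lra.
Qed.

Lemma sum_trunc_exp_on a b z w :
  \sum_(k <- s) trunc_exp_on a b z k w = row_count a b w * trunc_exp z w.
Proof.
rewrite /row_count mulr_suml; apply: eq_bigr => k _.
by rewrite /trunc_exp_on; case: ifP; rewrite ?mul1r ?mul0r.
Qed.

Section Count.
Variables (theta M : R).
Hypothesis hM : has_mean P0 (fun w => expR (theta * X0 w)) M.
Hypothesis M0 : 0 < M.

(** Under the tilted law a summand lies in [[u, v]] with probability [q / M]. Positive [l] gives the
    upper tail of the count and negative [l] the lower tail, with [x] the threshold per summand. *)
Lemma row_count_tail (u v q l x : R) : - 2^-1 <= l <= 2^-1 ->
  has_mean P0 (fun w => if u <= X0 w <= v then expR (theta * X0 w) else 0) q ->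
  exists2 e, has_mean P (fun w =>
      if (size s)%:R * (l * x) <= l * row_count u v w
      then expR (theta * row_sum w) else 0) e &
    e <= (M * expR (q / M * (l + 2 * l ^+ 2) - l * x)) ^+ size s.
Proof.
move=> hl hq; have q0 := has_mean_ge0 _ _ hq.
pose g (y : R) := if u <= y <= v then l else 0.
have mg : measurable_fun [set: R] g.
  apply: measurable_fun_ifT => //.
  by apply: measurable_and; apply: measurable_fun_ler.
(* Splitting [M] into the mass [q'] outside the interval and [q] inside makes the exponential moment
   of the count explicit, namely [q' + expR l * q] per summand. *)
have [q' hq' _] : exists2 q', has_mean P0 (fun w =>
    if u <= X0 w <= v then 0 else expR (theta * X0 w)) q' & q' <= M.
  apply: (has_mean_dominated _ _ _ _ _ hM).
    apply: measurable_fun_ifT => //; last exact: has_mean_measurable hM.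
    by apply: measurable_and; apply: measurable_fun_ler => //; exact: measurable_funP.
  by move=> w; case: ifP; rewrite ?lexx expR_ge0.
have sum_q : q' + q = M.
  have hsum := has_meanD _ _ _ _ hq' hq.
  by apply/eqP; rewrite eq_le; apply/andP; split;
    [apply: (has_mean_le _ _ _ _ hsum hM)|apply: (has_mean_le _ _ _ _ hM hsum)] => w;
    case: ifP; rewrite ?add0r ?addr0.
have ha : has_mean P0 (fun w => expR (theta * X0 w + g (X0 w))) (q' + expR l * q).
  apply: eq_has_mean (has_meanD _ _ _ _ hq' (has_meanZ _ _ _ (expR_ge0 l) hq)) => w.
  rewrite /g expRD; case: ifP => _; first by rewrite add0r mulrC.
  by rewrite mulr0 addr0 expR0 mulr1.
have [e he hle] := row_chernoff theta g ((size s)%:R * (l * x)) _ mg ha.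
exists e.
  apply: eq_has_mean he => w; congr (if _ <= _ then _ else _).
  rewrite /row_count mulr_sumr; apply: eq_bigr => k _; rewrite /g.
  by case: ifP; rewrite ?mulr1 ?mulr0.
apply: (le_trans hle).
have a0 := has_mean_ge0 _ _ ha.
rewrite -mulrN expRM_natl -exprMn mulrC lerXn2r ?nnegrE ?mulr_ge0 ?expR_ge0// ?(ltW M0)//.
rewrite expRD mulrA -mulrN ler_wpM2r ?expR_ge0//.
have -> : q' + expR l * q = M * (1 + q / M * (expR l - 1)).
  by rewrite -sum_q; field; rewrite sum_q gt_eqF.
rewrite ler_wpM2l ?(ltW M0)//; apply: le_trans (expR_ge1Dx _) _.
rewrite ler_expR ler_wpM2l ?divr_ge0 ?(ltW M0)//.
have := expR_le_quadratic l hl; lra.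
Qed.

End Count.

(** * Comparing truncated means at two levels *)

Section Truncated.
Variables (theta M u1 u2 v1 v2 qA qB eta z : R).
Hypotheses (theta1 : theta <= 1) (u12 : u1 <= u2) (uv : u2 < v1) (v12 : v1 <= v2).
Hypothesis hM : has_mean P0 (fun w => expR (theta * X0 w)) M.
Hypothesis hqA : has_mean P0
  (fun w => if u1 <= X0 w <= u2 then expR (theta * X0 w) else 0) qA.
Hypothesis hqB : has_mean P0
  (fun w => if v1 <= X0 w <= v2 then expR (theta * X0 w) else 0) qB.
Hypotheses (M0 : 0 < M) (qA0 : 0 < qA) (qB0 : 0 < qB) (eta01 : 0 < eta < 1).
Hypothesis s_gt0 : (0 < size s)%N.

Let z1 := z - (v2 - u1).
Let rho0 := expR (- ((1 - theta) * (v1 - u2))).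
Let n := (size s)%:R : R.

Lemma raise_sum : exists a b, [/\
  has_mean P (fun w => row_count u1 u2 w * trunc_exp z1 w) a,
  has_mean P (fun w => row_count v1 v2 w * trunc_exp z w) b &
  a * qB <= rho0 * qA * b].
Proof.
have : exists a b, [/\
    has_mean P (fun w => \sum_(k <- s) trunc_exp_on u1 u2 z1 k w) a,
    has_mean P (fun w => \sum_(k <- s) trunc_exp_on v1 v2 z k w) b &
    a * qB <= rho0 * qA * b].
  have : {subset s <= s} by [].
  (* Only the range of summation varies; [trunc_exp_on] still refers to the whole row [s], and the
     inclusion provides the membership that [raise_one] asks for. *)
  elim: {1 3 4}s => [_|k t IH ts].
    exists 0, 0; rewrite mul0r mulr0.
    by split => //; apply: eq_has_mean (has_mean_cst 0 _) => // w; rewrite big_nil.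
  have [|a [b [ha hb hab]]] := IH; first by move=> j jt; rewrite ts// inE jt orbT.
  have [a' ha' _] := has_mean_trunc_exp_on u1 u2 z1 k.
  have [b' hb' _] := has_mean_trunc_exp_on v1 v2 z k.
  have ks : k \in s by rewrite ts// inE eqxx.
  have hab' := raise_one theta u1 u2 v1 v2 qA qB theta1 hqA hqB z k a' b' ks ha' hb'.
  exists (a' + a), (b' + b); split.
  - by apply: eq_has_mean (has_meanD _ _ _ _ ha' ha) => w; rewrite big_cons.
  - by apply: eq_has_mean (has_meanD _ _ _ _ hb' hb) => w; rewrite big_cons.
  - by rewrite mulrDl mulrDr lerD.
move=> [a [b [ha hb hab]]]; exists a, b; split => //.
- by apply: eq_has_mean ha => w; rewrite sum_trunc_exp_on.
- by apply: eq_has_mean hb => w; rewrite sum_trunc_exp_on.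
Qed.

Lemma has_mean_trunc_exp y : exists2 f, has_mean P (trunc_exp y) f & f <= expR y.
Proof.
apply: (has_mean_dominated _ _ _ _ _ (has_mean_cst _ (expR_ge0 y))).
  exact: measurable_trunc_exp.
exact: trunc_exp_bounds.
Qed.

Lemma trunc_exp_le_tilt y w : y <= z ->
  trunc_exp y w <= expR ((1 - theta) * z) * expR (theta * row_sum w).
Proof.
move=> yz; rewrite /trunc_exp; case: ifPn => [hy|_]; last by rewrite mulr_ge0 ?expR_ge0.
rewrite -expRD ler_expR.
have : 0 <= (1 - theta) * (z - row_sum w) by rewrite mulr_ge0 ?subr_ge0// (le_trans hy).
lra.
Qed.

(** The Chernoff factor for a count that deviates from its tilted mean by the fraction [eta], from
    [row_count_tail] with [l] equal to [- (eta / 4)] or [eta / 4]. *)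
Let r (q : R) := expR (- (q / M * eta ^+ 2 / 8)).

(** Up to tilted errors the count in [[u1, u2]] is at least [(1 - eta) * n * pA] and that in
    [[v1, v2]] at most [(1 + eta) * n * pB]. Inserted into [raise_sum], these cancel the masses [qA]
    and [qB] and leave the factor [rho0]. *)
Lemma truncated_mean_le (f1 f2 : R) :
  has_mean P (trunc_exp z1) f1 -> has_mean P (trunc_exp z) f2 ->
  (1 - eta) * f1 <= rho0 * ((1 + eta) * f2 +
      M / qB * (expR ((1 - theta) * z) * (M * r qB) ^+ size s)) +
    expR ((1 - theta) * z) * (M * r qA) ^+ size s.
Proof.
move=> hf1 hf2; have [eta0 eta1] := andP eta01.
have n0 : 0 < n by rewrite ltr0n.
have [a [b [ha hb hab]]] := raise_sum.
have [pA pAE] : exists p, p = qA / M by exists (qA / M).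
have [pB pBE] : exists p, p = qB / M by exists (qB / M).
have pA0 : 0 < pA by rewrite pAE divr_gt0.
have pB0 : 0 < pB by rewrite pBE divr_gt0.
have hl1 : - 2^-1 <= - (eta / 4) <= 2^-1 by lra.
have hl2 : - 2^-1 <= eta / 4 <= 2^-1 by lra.
have [eA heA leA] := row_count_tail theta M hM M0 u1 u2 qA _ ((1 - eta) * pA) hl1 hqA.
have [eB heB leB] := row_count_tail theta M hM M0 v1 v2 qB _ ((1 + eta) * pB) hl2 hqB.
set E := expR ((1 - theta) * z).
have E0 : 0 <= E by exact: expR_ge0.
have z1z : z1 <= z.
  by rewrite gerBl subr_ge0 (le_trans u12)// (le_trans (ltW uv)).
(* Where the count is too small, the truncated exponential is replaced by [E] times the tilted
   weight, whose mean there is [eA]. *)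
have hA : (1 - eta) * n * pA * f1 <= a + n * pA * E * eA.
  have k0 : 0 <= (1 - eta) * n * pA by rewrite !mulr_ge0 ?(ltW n0) ?(ltW pA0)//; lra.
  have k1 : 0 <= n * pA * E by rewrite !mulr_ge0// ltW.
  apply: (has_mean_le _ _ _ _ (has_meanZ _ _ _ k0 hf1)
    (has_meanD _ _ _ _ ha (has_meanZ _ _ _ k1 heA))) => w.
  have /andP[c0 cn] := row_count_bounds u1 u2 w.
  have /andP[F0 _] := trunc_exp_bounds z1 w.
  have FE := trunc_exp_le_tilt z1 w z1z.
  case: ifPn => [_|].
    have h1 : n * pA * trunc_exp z1 w <=
        n * pA * (E * expR (theta * row_sum w)).
      by rewrite ler_wpM2l// mulr_ge0 ?ltW.
    have h2 : 0 <= row_count u1 u2 w * trunc_exp z1 w by exact: mulr_ge0.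
    have h3 : 0 <= eta * (n * pA * trunc_exp z1 w).
      by rewrite !mulr_ge0// ltW.
    by lra.
  rewrite -ltNge mulr0 addr0 => hc; apply: ler_wpM2r => //.
  by rewrite -/n in hc; nra.
(* Where the count is too large, it is bounded by [n]. *)
have hB : b <= (1 + eta) * n * pB * f2 + n * E * eB.
  have k0 : 0 <= (1 + eta) * n * pB by rewrite !mulr_ge0 ?(ltW n0) ?(ltW pB0)//; lra.
  have k1 : 0 <= n * E by rewrite !mulr_ge0// ltW.
  apply: (has_mean_le _ _ _ _ hb
    (has_meanD _ _ _ _ (has_meanZ _ _ _ k0 hf2) (has_meanZ _ _ _ k1 heB))) => w.
  have /andP[c0 cn] := row_count_bounds v1 v2 w.
  have /andP[F0 _] := trunc_exp_bounds z w.
  have FE := trunc_exp_le_tilt z w (lexx z).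
  case: ifPn => [_|].
    have h1 : row_count v1 v2 w * trunc_exp z w <=
        n * (E * expR (theta * row_sum w)).
      by rewrite ler_pM.
    have h3 : 0 <= (1 + eta) * n * pB * trunc_exp z w by exact: mulr_ge0.
    by rewrite -mulrA; lra.
  rewrite -ltNge mulr0 addr0 => hc; apply: ler_wpM2r => //.
  by rewrite -/n in hc; nra.
have rAE : expR (qA / M * (- (eta / 4) + 2 * (- (eta / 4)) ^+ 2) -
    - (eta / 4) * ((1 - eta) * pA)) = r qA.
  by rewrite /r pAE; congr expR; field; rewrite gt_eqF.
have rBE : expR (qB / M * (eta / 4 + 2 * (eta / 4) ^+ 2) -
    eta / 4 * ((1 + eta) * pB)) = r qB.
  by rewrite /r pBE; congr expR; field; rewrite gt_eqF.
rewrite rAE in leA; rewrite rBE in leB.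
have K0 : 0 < n * pA * qB by rewrite !mulr_gt0.
rewrite -(ler_pM2l K0).
have rho0_ge0 : 0 <= rho0 by exact: expR_ge0.
have step1 : n * pA * qB * ((1 - eta) * f1) <= rho0 * qA * b + n * pA * qB * (E * eA).
  have := ler_wpM2r (ltW qB0) hA; lra.
have step2 : rho0 * qA * b <= n * pA * qB * (rho0 * ((1 + eta) * f2 + M / qB * (E * eB))).
  have -> : n * pA * qB * (rho0 * ((1 + eta) * f2 + M / qB * (E * eB))) =
      rho0 * qA * ((1 + eta) * n * pB * f2 + n * E * eB).
    by rewrite pAE pBE; field; rewrite !gt_eqF.
  by rewrite ler_wpM2l// mulr_ge0// ltW.
apply: (le_trans step1); rewrite [leRHS]mulrDr lerD//.
  apply: (le_trans step2); rewrite ler_wpM2l ?(ltW K0)// ler_wpM2l// lerD2l.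
  by rewrite ler_wpM2l ?divr_ge0 ?(ltW M0) ?(ltW qB0)// ler_wpM2l.
by rewrite ler_wpM2l ?(ltW K0)// ler_wpM2l.
Qed.

End Truncated.
End RowSums.

(** * Tail and truncation bounds *)

Section Nondegenerate.
Context {R : realType} {d : measure_display} {T : measurableType d}
  {P : probability T R} (X : {RV P >-> R}).

Lemma exists_prob_neq0 (A : nat -> set T) : (forall n, measurable (A n)) ->
  P (\bigcup_n A n) != 0%E -> exists n, P (A n) != 0%E.
Proof.
move=> mA; apply: contra_neqP => /forallNP hA.
apply: measure_negligible; first exact: bigcup_measurable.
apply: negligible_bigcup => n; apply/negligibleP => //.
by apply/eqP; have /negP := hA n; rewrite negbK.
Qed.

Let mle u : measurable [set w | X w <= u].
Proof.
rewrite (_ : [set w | _] = X @^-1` `]-oo, u]); first exact: measurable_preimage.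
by apply/seteqP; split => w /=; rewrite in_itv.
Qed.

Let mge u : measurable [set w | u <= X w].
Proof.
rewrite (_ : [set w | _] = X @^-1` `[u, +oo[); first exact: measurable_preimage.
by apply/seteqP; split => w /=; rewrite in_itv /= andbT.
Qed.

(** Otherwise, for all [u < v], one of [X <= u] and [v <= X] is a null event, and then [X] equals
    almost surely the supremum [b] of the levels [u] for which [X <= u] is null. *)
Lemma nondegenerate_split : nondegenerate_rv P X ->
  exists u v, [/\ u < v, P [set w | X w <= u] != 0%E & P [set w | v <= X w] != 0%E].
Proof.
move=> nd; apply: contrapT => /forallNP h0.
have h u v : u < v -> P [set w | X w <= u] = 0%E \/ P [set w | v <= X w] = 0%E.
  move=> uv; have [->|pu] := eqVneq (P [set w | X w <= u]) 0%E; first by left.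
  have [->|pv] := eqVneq (P [set w | v <= X w]) 0%E; first by right.
  by have /forallNP/(_ v) := h0 u; case.
have PT : P [set: T] != 0%E.
  by rewrite probability_setT; apply/eqP => -[] /eqP; rewrite oner_eq0.
have [v0 hv0] : exists n : nat, P [set w | - n%:R <= X w] != 0%E.
  apply: (exists_prob_neq0 (fun n : nat => [set w | - n%:R <= X w])) => //.
  rewrite (_ : \bigcup_n _ = setT)//; apply/seteqP; split => // w _.
  exists (Num.truncn `|X w|).+1 => //=.
  by rewrite lerNl; apply: le_trans (ltW (truncnS_gt _)); rewrite -normrN ler_norm.
have [u0 hu0] : exists n : nat, P [set w | X w <= n%:R] != 0%E.
  apply: (exists_prob_neq0 (fun n : nat => [set w | X w <= n%:R])) => //.
  rewrite (_ : \bigcup_n _ = setT)//; apply/seteqP; split => // w _.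
  exists (Num.truncn `|X w|).+1 => //=.
  by apply: le_trans (ltW (truncnS_gt _)); rewrite ler_norm.
pose E := [set u | P [set w | X w <= u] = 0%E].
have Edown u v : u <= v -> E v -> E u.
  move=> uv Ev; apply/eqP; rewrite eq_le measure_ge0 andbT -Ev.
  by apply: le_measure; rewrite ?inE// => w /= /le_trans; apply.
have E0 : E (- v0%:R - 1).
  by have [//|/eqP] := h (- v0%:R - 1) (- v0%:R) ltac:(lra); rewrite (negPf hv0).
have ubE : ubound E u0%:R.
  move=> u Eu; rewrite leNgt; apply/negP => /ltW/Edown-/(_ Eu)/eqP.
  by rewrite (negPf hu0).
have supE : has_sup E by split; [exists (- v0%:R - 1)|exists u0%:R].
pose b := sup E.
apply: nd; exists b; apply: (negligibleS (A := [set w | X w < b] `|` [set w | b < X w])).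
  by move=> w /= /eqP; rewrite neq_lt => /orP.
have inv_gt0 n : 0 < n.+1%:R^-1 :> R by rewrite invr_gt0.
apply: negligibleU.
  rewrite (_ : [set w | _] = \bigcup_n [set w | X w <= b - n.+1%:R^-1]).
    apply: negligible_bigcup => n; apply/negligibleP => //.
    have [e Ee be] := sup_adherent (inv_gt0 n) supE.
    by apply: Edown Ee; exact: ltW.
  apply/seteqP; split => w /=.
    move=> Xb; have bX : 0 < b - X w by rewrite subr_gt0.
    exists (Num.truncn (b - X w)^-1) => //=.
    rewrite lerBrDr -lerBrDl -[leRHS]invrK lef_pV2 ?posrE ?invr_gt0//.
    by rewrite ltW// truncnS_gt.
  move=> [n _ /= Xn]; apply: (le_lt_trans Xn).
  by rewrite ltrBlDr ltrDl.
rewrite (_ : [set w | _] = \bigcup_n [set w | b + n.+1%:R^-1 <= X w]).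
  apply: negligible_bigcup => n; apply/negligibleP => //.
  (* The midpoint lies above the supremum [b], so it is not in [E] and the other alternative must
     hold. *)
  have bn : b + n.+1%:R^-1 / 2 < b + n.+1%:R^-1.
    by move: (inv_gt0 n); move: (_^-1) => e; lra.
  have [En|//] := h _ _ bn.
  have /(_ _ En) := ub_le_sup (proj2 supE); rewrite -/b.
  by rewrite gerDl leNgt divr_gt0.
apply/seteqP; split => w /=.
  move=> Xb; have bX : 0 < X w - b by rewrite subr_gt0.
  exists (Num.truncn (X w - b)^-1) => //=.
  rewrite addrC -lerBrDr -[leRHS]invrK lef_pV2 ?posrE ?invr_gt0//.
  by rewrite ltW// truncnS_gt.
move=> [n _ /= Xn]; apply: lt_le_trans Xn.
by rewrite ltrDl.
Qed.

Lemma nondegenerate_intervals : nondegenerate_rv P X ->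
  exists u1 u2 v1 v2, [/\ u1 <= u2, u2 < v1, v1 <= v2 &
    P [set w | u1 <= X w <= u2] != 0%E /\ P [set w | v1 <= X w <= v2] != 0%E].
Proof.
move=> /nondegenerate_split[u [v [uv pu pv]]].
have mbetw a b : measurable [set w | a <= X w <= b].
  rewrite (_ : [set w | _] = [set w | a <= X w] `&` [set w | X w <= b]).
    exact: measurableI.
  by apply/seteqP; split => w /= => [/andP|[-> ->]].
have [n hn] : exists n : nat, P [set w | u - n%:R <= X w <= u] != 0%E.
  apply: (exists_prob_neq0 (fun n : nat => [set w | u - n%:R <= X w <= u])) => //.
  rewrite (_ : \bigcup_n _ = [set w | X w <= u])//.
  apply/seteqP; split => [w [n _ /= /andP[]]//|w /= Xu].
  exists (Num.truncn (u - X w)).+1 => //=; rewrite Xu andbT.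
  by rewrite lerBlDr -lerBlDl ltW// truncnS_gt.
have [m hm] : exists m : nat, P [set w | v <= X w <= v + m%:R] != 0%E.
  apply: (exists_prob_neq0 (fun m : nat => [set w | v <= X w <= v + m%:R])) => //.
  rewrite (_ : \bigcup_n _ = [set w | v <= X w])//.
  apply/seteqP; split => [w [m _ /= /andP[]]//|w /= Xv].
  exists (Num.truncn (X w - v)).+1 => //=; rewrite Xv /=.
  by rewrite -lerBlDl ltW// truncnS_gt.
exists (u - n%:R), u, v, (v + m%:R); split => //.
- by rewrite gerBl.
- by rewrite lerDl.
Qed.

Lemma has_mean_exp_between (theta M a b : R) :
  has_mean P (fun w => expR (theta * X w)) M -> 0 <= theta ->
  P [set w | a <= X w <= b] != 0%E ->
  exists2 q, has_mean P (fun w => if a <= X w <= b then expR (theta * X w) else 0) q &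
    0 < q.
Proof.
move=> hM theta0 hab.
have mab : measurable_fun [set: T] (fun w => a <= X w <= b).
  by apply: measurable_and; apply: measurable_fun_ler => //; exact: measurable_funP.
have [q hq _] : exists2 q, has_mean P
    (fun w => if a <= X w <= b then expR (theta * X w) else 0) q & q <= M.
  apply: (has_mean_dominated _ _ _ _ _ hM).
    apply: measurable_fun_ifT => //; exact: has_mean_measurable hM.
  by move=> w; case: ifP; rewrite ?lexx expR_ge0.
exists q => //.
have hp : has_mean P (fun w => expR (theta * a) * (if a <= X w <= b then 1 else 0))
    (expR (theta * a) * fine (P [set w | a <= X w <= b])).
  exact: has_meanZ (expR_ge0 _) (has_mean_prob _ mab).
apply: (@lt_le_trans _ _ (expR (theta * a) * fine (P [set w | a <= X w <= b]))).
  rewrite mulr_gt0 ?expR_gt0// fine_gt0// lt0e hab measure_ge0 /=.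
  rewrite ltey_eq fin_num_measure//.
  by rewrite -[X in measurable X]setTI; exact: (mab measurableT [set true]).
apply: (has_mean_le _ _ _ _ hp hq) => w; case: ifPn => [/andP[aX _]|_]; last by rewrite mulr0.
by rewrite mulr1 ler_expR ler_wpM2l.
Qed.

End Nondegenerate.

(** * Truncated means and lower tails of one row *)

Section RowBounds.
Context {R : realType} {d0 : measure_display} {T0 : measurableType d0}
  {P0 : probability T0 R} (X0 : {RV P0 >-> R})
  {d : measure_display} {T : measurableType d} {P : probability T R}
  {I : choiceType} (X : I -> {RV P >-> R}).
Hypothesis X_copies : independent_copies X X0.

Definition row_tail (s : seq I) (z : R) : R := fine (P [set w | z < row_sum X s w]).

Lemma has_mean_row_tail s z :
  has_mean P (fun w => if z < row_sum X s w then 1 else 0) (row_tail s z).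
Proof.
apply: has_mean_prob; apply: measurable_fun_ltr => //.
exact: measurable_row_sum.
Qed.

Lemma row_tail_ge0 s z : 0 <= row_tail s z.
Proof. by rewrite fine_ge0. Qed.

(** The mean truncated at [z] exceeds the one truncated at [z - K] by at most [expR z] times the
    tail at [z - K], and [truncated_mean_le] bounds the latter by a fraction of the former plus an
    error. Eliminating it gives constants independent of [s] and [z]. *)
Lemma row_trunc_mean_le (theta M : R) : nondegenerate_rv P0 X0 ->
  0 <= theta < 1 -> 0 < M -> has_mean P0 (fun w => expR (theta * X0 w)) M ->
  exists K kappa C r, [/\ 0 <= K, 0 < kappa, 0 <= C, 0 <= r < 1 &
    forall s z, uniq s -> (0 < size s)%N ->
    exists2 f, has_mean P (trunc_exp X s z) f &
      kappa * f <= expR z * row_tail s (z - K) +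
        C * (expR ((1 - theta) * z) * (M * r) ^+ size s)].
Proof.
move=> nd /andP[theta0 theta1] M0 hM.
have [u1 [u2 [v1 [v2 [u12 uv v12 [pA pB]]]]]] := nondegenerate_intervals X0 nd.
have [qA hqA qA0] := has_mean_exp_between X0 theta M u1 u2 hM theta0 pA.
have [qB hqB qB0] := has_mean_exp_between X0 theta M v1 v2 hM theta0 pB.
set rho0 := expR (- ((1 - theta) * (v1 - u2))).
have rho0_ge0 : 0 <= rho0 by exact: expR_ge0.
have rho0_lt1 : rho0 < 1.
  by rewrite -expR0 ltr_expR oppr_lt0 mulr_gt0// subr_gt0.
(* With this [eta], [kappa = 1 - eta - rho0 * (1 + eta)] is at least [(1 - rho0) / 2], hence
   positive. *)
pose eta := (1 - rho0) / 4.
have eta01 : 0 < eta < 1 by rewrite /eta; lra.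
pose r q := expR (- (q / M * eta ^+ 2 / 8)).
have r_ge0 q : 0 <= r q by exact: expR_ge0.
have r_lt1 q : 0 < q -> r q < 1.
  move=> q0; rewrite -expR0 ltr_expR oppr_lt0 divr_gt0// mulr_gt0 ?divr_gt0//.
  by rewrite exprn_gt0//; case/andP: eta01.
exists (v2 - u1), ((1 - eta) - rho0 * (1 + eta)), (rho0 * (M / qB) + 1), (Num.max (r qA) (r qB)).
have rho_eta : rho0 * eta <= eta by case/andP: eta01 => e0 _; rewrite ler_piMl ?ltW.
have MqB : 0 <= M / qB by rewrite divr_ge0 ?ltW.
split.
- by rewrite subr_ge0 (le_trans u12)// (le_trans (ltW uv)).
- by move: rho_eta; rewrite mulrDr mulr1 /eta; lra.
- by rewrite addr_ge0// mulr_ge0.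
- by rewrite le_max r_ge0 gt_max !r_lt1.
move=> s z us s0.
have [f1 hf1 _] := has_mean_trunc_exp X s (z - (v2 - u1)).
have [f2 hf2 _] := has_mean_trunc_exp X s z.
exists f2 => //.
have h := truncated_mean_le X0 X X_copies s us theta M u1 u2 v1 v2 qA qB eta z
  (ltW theta1) u12 uv v12 hM hqA hqB M0 qA0 qB0 eta01 s0 f1 f2 hf1 hf2.
have f21 : f2 <= f1 + expR z * row_tail s (z - (v2 - u1)).
  apply: (has_mean_le _ _ _ _ hf2 (has_meanD _ _ _ _ hf1
    (has_meanZ _ _ _ (expR_ge0 z) (has_mean_row_tail s (z - (v2 - u1)))))) => w.
  rewrite /trunc_exp ltNge; case: (leP (row_sum X s w) (z - (v2 - u1))) => hw /=.
    by rewrite mulr0 addr0; case: ifP; rewrite ?expR_ge0.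
  by rewrite mulr1 add0r; case: ifPn => [hz|_]; rewrite ?ler_expR ?expR_ge0.
move: h; rewrite -/rho0 -/(r qA) -/(r qB); set E := expR ((1 - theta) * z).
set rr := Num.max _ _.
have hr q : r q <= rr -> E * (M * r q) ^+ size s <= E * (M * rr) ^+ size s.
  move=> hq; rewrite ler_wpM2l ?expR_ge0// lerXn2r ?nnegrE ?mulr_ge0 ?(ltW M0)//.
    by apply: le_trans hq.
  by rewrite ler_wpM2l ?(ltW M0).
have hA : E * (M * r qA) ^+ size s <= E * (M * rr) ^+ size s.
  by apply: hr; rewrite le_max lexx.
have hB : rho0 * (M / qB * (E * (M * r qB) ^+ size s)) <=
    rho0 * (M / qB * (E * (M * rr) ^+ size s)).
  by rewrite ler_wpM2l// ler_wpM2l// hr// le_max lexx orbT.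
have pz0 : 0 <= expR z * row_tail s (z - (v2 - u1)).
  by rewrite mulr_ge0 ?expR_ge0 ?row_tail_ge0.
have [eta0 eta1] := andP eta01.
have eta1' : 0 <= 1 - eta by lra.
have := ler_wpM2l eta1' f21.
have := mulr_ge0 (ltW eta0) pz0.
move: hA hB pz0 f21.
move: (E * (M * r qA) ^+ size s) (E * (M * r qB) ^+ size s) (E * (M * rr) ^+ size s).
move: (expR z * row_tail _ _) => p a b e.
move: (M / qB) => m; lra.
Qed.

(** Cramer's lower bound: between [x1 * n] and [x2 * n] the weight [expR (t * S)] is at most
    [expR (t * x2) ^+ n], and the two outer ranges are handled by Chernoff bounds with tilts
    [t - l1] and [t + l2]. *)
Lemma row_tail_lower (t x1 x2 l1 l2 M M1 M2 : R) (s : seq I) : uniq s -> 0 <= t ->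
  0 <= l1 -> 0 <= l2 ->
  has_mean P0 (fun w => expR (t * X0 w)) M ->
  has_mean P0 (fun w => expR ((t - l1) * X0 w)) M1 ->
  has_mean P0 (fun w => expR ((t + l2) * X0 w)) M2 ->
  M ^+ size s <= expR (t * x2) ^+ size s * row_tail s (x1 * (size s)%:R) +
    (expR (l1 * x1) * M1) ^+ size s + (expR (- (l2 * x2)) * M2) ^+ size s.
Proof.
move=> us t0 l10 l20 hM hM1 hM2; set n := (size s)%:R : R.
have mlin (c : R) : measurable_fun [set: R] (fun x : R => c * x).
  exact: measurable_funM.
have hM1' : has_mean P0 (fun w => expR (t * X0 w + - l1 * X0 w)) M1.
  by apply: eq_has_mean hM1 => w; rewrite -mulrDl.
have hM2' : has_mean P0 (fun w => expR (t * X0 w + l2 * X0 w)) M2.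
  by apply: eq_has_mean hM2 => w; rewrite -mulrDl.
have [e1 he1 le1] := row_chernoff X0 X X_copies s us t (fun x => - l1 * x)
  (n * - (l1 * x1)) M1 (mlin _) hM1'.
have [e2 he2 le2] := row_chernoff X0 X X_copies s us t (fun x => l2 * x)
  (n * (l2 * x2)) M2 (mlin _) hM2'.
have -> : (expR (l1 * x1) * M1) ^+ size s = expR (- (n * - (l1 * x1))) * M1 ^+ size s.
  by rewrite exprMn -expRM_natl mulrN opprK.
have -> : (expR (- (l2 * x2)) * M2) ^+ size s = expR (- (n * (l2 * x2))) * M2 ^+ size s.
  by rewrite exprMn -expRM_natl mulrN.
apply: (@le_trans _ _ (expR (t * x2) ^+ size s * row_tail s (x1 * n) + e1 + e2)); last first.
  by rewrite lerD// lerD2l.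
have hS := has_mean_exp_row_sum X0 X X_copies s us t M hM.
rewrite -expRM_natl -/n.
apply: (has_mean_le _ _ _ _ hS (has_meanD _ _ _ _ (has_meanD _ _ _ _
  (has_meanZ _ _ _ (expR_ge0 (n * (t * x2))) (has_mean_row_tail s (x1 * n))) he1) he2)) => w.
rewrite -!mulr_sumr -/(row_sum X s w).
move: (row_sum X s w) => S.
have E0 : 0 <= expR (t * S) by exact: expR_ge0.
have E1 : 0 <= expR (n * (t * x2)) by exact: expR_ge0.
case: (ltP (x1 * n) S) => hS1.
  case: (ltP S (x2 * n)) => hS2.
    have : expR (t * S) <= expR (n * (t * x2)).
      by rewrite ler_expR mulrCA ler_wpM2l// mulrC ltW.
    by case: ifP => _; case: ifP => _; lra.
  rewrite [X in _ + (if X then _ else _)](_ : _ = true); first by case: ifP => _; lra.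
  by rewrite mulrCA ler_wpM2l// mulrC.
rewrite [X in _ + (if X then _ else _) + _](_ : _ = true); first by case: ifP => _; lra.
by rewrite mulNr mulrN lerN2 mulrCA ler_wpM2l// mulrC.
Qed.

Lemma critical_row_tail (c : R) :
  (forall t : R, 0 <= t -> cgf P0 X0 t \is a fin_num) ->
  0 < c -> c < critical_rate P0 X0 ->
  exists theta v, [/\ 0 < theta < 1,
    c + log_mgf X0 theta = theta * v &
    forall e, 0 < e -> exists2 r, 0 <= r < 1 & forall s, uniq s ->
      1 - 2 * r ^+ size s <=
        expR c ^+ size s * row_tail s ((v - e) * (size s)%:R)].
Proof.
move=> hcgf c0 c1.
have [theta [theta01 vE htilt]] := critical_tilt X0 hcgf c c0 c1.
exists theta, (tilted_mean X0 theta); split => // e e0.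
have [t [t0 mt psit]] := htilt e e0.
have [x2 [l1 [l2 [q1 [q2 [r [[l10 l20 tl1 tl2] [q1r q2r r1] h1 h2 h3]]]]]]] :=
  chernoff_rates _ _ _ _ _ (is_derive_log_mgf X0 hcgf t t0) t0 mt psit.
have hM (y : R) : 0 <= y -> has_mean P0 (fun w => expR (y * X0 w)) (expR (log_mgf X0 y)).
  move=> y0; rewrite lnK ?posrE ?exp_moment0_gt0//; split.
  - by apply: measurableT_comp => //; apply: measurable_funM => //; exact: measurable_funP.
  - by move=> w; exact: expR_ge0.
  - exact: exp_moment0E.
have [q10 q1le] := andP q1r; have [q20 q2le] := andP q2r.
have r0 : 0 <= r := le_trans q10 q1le.
exists r; first by rewrite r0 r1.
move=> s us; have := row_tail_lower t (tilted_mean X0 theta - e) x2 l1 l2 _ _ _ s us (ltW t0) l10 l20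
  (hM t (ltW t0)) (hM _ tl1) (hM _ tl2).
(* Every term carries the factor [expR (log_mgf X0 t) ^+ size s], which cancels and leaves [expR c]
   and the rates [q1], [q2]. *)
rewrite h1 h2 h3 !exprMn -mulrA -!mulrDr ler_pMr ?exprn_gt0 ?expR_gt0//.
move=> hp; rewrite lerBlDr (le_trans hp)// -addrA lerD2l mulr_natl mulr2n.
by rewrite lerD// lerXn2r ?nnegrE.
Qed.

End RowBounds.

(** * Concentration of the sum over rows *)

Section Rows.
Context {R : realType} {d : measure_display} {T : measurableType d}
  {P : probability T R} (X : nat * nat -> {RV P >-> R}).

Definition row (n i : nat) : seq (nat * nat) := [seq (i, j) | j <- iota 0 n].

Lemma size_row n i : size (row n i) = n.
Proof. by rewrite size_map size_iota. Qed.

Lemma uniq_row n i : uniq (row n i).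
Proof. by rewrite map_inj_uniq ?iota_uniq// => j k []. Qed.

Lemma Zsum_row (N : nat -> nat) (n : nat) (w : T) :
  Zsum X N n w = \sum_(i <- iota 0 (N n)) expR (row_sum X (row n i) w).
Proof.
have -> : iota 0 (N n) = index_iota 0 (N n) by rewrite /index_iota subn0.
rewrite big_mkord /Zsum; apply: eq_bigr => i _.
rewrite /row_sum expR_sum big_map.
have -> : iota 0 n = index_iota 0 n by rewrite /index_iota subn0.
by rewrite big_mkord.
Qed.

Lemma indep_row_sums (n : nat) (t : seq nat) : mutually_independent X -> (0 < n)%N -> uniq t ->
  indep_seq [seq row_sum X (row n i) | i <- t] (P := P).
Proof.
move=> hX n0 ut.
have uniq_all : uniq [seq (i, j) | i <- t, j <- iota 0 n].
  by apply: allpairs_uniq => //; [exact: iota_uniq | move=> [? ?] [? ?] _ _ [-> ->]].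
have := indep_seq_family _ X _ hX uniq_all.
rewrite map_flatten -map_comp; set rows := map _ t.
have hrows : all (fun r => size r != 0%N) rows.
  rewrite all_map; apply: sub_all (all_predT t) => i _ /=.
  by rewrite size_map size_row -lt0n.
move=> /(indep_seq_row_sums _ hrows); rewrite -map_comp.
congr indep_seq; apply: eq_map => i.
by apply/funext => w; rewrite /= /row_sum big_map.
Qed.

Lemma prod_prob_le (L : seq (T -> R)) (x : R) : measurable_seq L ->
  exists2 p, prod_prob L (fun=> `]-oo, x]%classic) (P := P) = p%:E &
    0 <= p <= expR (- \sum_(U <- L) fine (P [set w | x < U w])).
Proof.
elim: L => [_|U L IH /measurable_seq_cons[mU /IH[p pE /andP[p0 pL]]]] /=.
  by exists 1 => //; rewrite big_nil oppr0 expR0 ler01 lexx.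
have mA : measurable [set w | x < U w].
  rewrite (_ : [set w | _] = U @^-1` `]x, +oo[); first exact: measurable_preimage.
  by apply/seteqP; split => w /=; rewrite in_itv /= andbT.
pose q := fine (P [set w | x < U w]).
have qE : P [set w | x < U w] = q%:E by rewrite fineK// fin_num_measure.
have UE : P (U @^-1` `]-oo, x]) = (1 - q)%:E.
  rewrite (_ : U @^-1` _ = ~` [set w | x < U w]).
    by rewrite probability_setC// qE EFinB.
  by apply/seteqP; split => w /=; rewrite in_itv /= leNgt => /negP.
have q1 : 0 <= 1 - q by rewrite -lee_fin -UE.
exists ((1 - q) * p); first by rewrite EFinM -UE; congr (_ * _)%E.
rewrite mulr_ge0//= big_cons opprD expRD ler_pM//.
exact: expR_ge1Dx.
Qed.

Lemma joint_event_map {I : eqType} (F : I -> T -> R) (t : seq I) (A : set R) w :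
  {in t, forall i, A (F i w)} -> joint_event [seq F i | i <- t] (fun=> A) w.
Proof.
elim: t => //= i t IH hA; split; first by apply: hA; rewrite inE eqxx.
by apply: IH => j jt; apply: hA; rewrite inE jt orbT.
Qed.

(** Let [sigma] be the sum of the tails. By independence all row sums stay below [x] with
    probability [p <= expR (- sigma)], so [(1 + sigma) * p <= 1]; as also [p >= 1 - b] with
    [b <= 2^-1], the bound [sigma <= 2 * b] follows. *)
Lemma sum_row_tail_le (n : nat) (t : seq nat) (x : R) (A : T -> bool) (b : R) :
  mutually_independent X -> (0 < n)%N -> uniq t ->
  has_mean P (fun w => if A w then 1 else 0) b -> b <= 2^-1 ->
  (forall w, ~~ A w -> {in t, forall i, row_sum X (row n i) w <= x}) ->
  \sum_(i <- t) row_tail X (row n i) x <= 2 * b.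
Proof.
move=> hX n0 ut hb b2 hA.
have [mL hL] := indep_row_sums n t hX n0 ut.
have [p pE /andP[p0 ple]] := prod_prob_le _ x mL.
have := hL (fun=> `]-oo, x]%classic) (fun=> measurable_itv _).
rewrite pE; set J := joint_event _ _ => JE.
have mJ : measurable J by apply: measurable_joint_event => // k; exact: measurable_itv.
have hJ : has_mean P (\1_J : T -> R) p.
  split; [exact: measurable_indic | by move=> w; rewrite indicE|].
  by rewrite integral_indic// setIT.
have b1p : 1 <= b + p.
  apply: (has_mean_le _ _ _ _ (has_mean_cst 1 _) (has_meanD _ _ _ _ hb hJ)) => // w.
  case: ifPn => [_|/hA hw]; first by rewrite lerDl indicE.
  rewrite add0r indicE mem_set//; apply: joint_event_map => i it /=.
  by rewrite in_itv /= hw.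
rewrite big_map in ple; set sigma := \sum_(i <- t) _ in ple *.
have s0 : 0 <= sigma by apply: sumr_ge0 => i _; exact: row_tail_ge0.
have : (1 + sigma) * p <= 1.
  rewrite -[leRHS](expRxMexpNx_1 sigma) ler_pM ?addr_ge0//.
  exact: expR_ge1Dx.
nra.
Qed.

End Rows.

(** * Consequences of a small deviation probability *)

Section Concentration.
Context {R : realType} {d0 : measure_display} {T0 : measurableType d0}
  {P0 : probability T0 R} (X0 : {RV P0 >-> R})
  {d : measure_display} {T : measurableType d} {P : probability T R}
  (X : nat * nat -> {RV P >-> R}).
Hypothesis X_copies : independent_copies X X0.

Lemma measurable_Zsum (N : nat -> nat) (n : nat) :
  measurable_fun [set: T] (Zsum X N n).
Proof.
rewrite (_ : Zsum X N n = fun w => \sum_(i <- iota 0 (N n)) expR (row_sum X (row n i) w)).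
  apply: measurable_sum => i; apply: measurableT_comp => //.
  exact: measurable_row_sum.
by apply/funext => w; exact: Zsum_row.
Qed.

Lemma measurable_deviation (N : nat -> nat) (n : nat) (a : R) :
  measurable_fun [set: T] (fun w => 2^-1 <= `|Zsum X N n w / a - 1|).
Proof.
apply: measurable_fun_ler => //; apply: measurableT_comp => //.
apply: measurable_funB => //; apply: measurable_funM => //.
exact: measurable_Zsum.
Qed.

Definition deviation_prob (N : nat -> nat) (n : nat) (a : R) : R :=
  fine (P [set w | 2^-1 <= `|Zsum X N n w / a - 1|]).

Lemma has_mean_deviation (N : nat -> nat) (n : nat) (a : R) :
  has_mean P (fun w => if 2^-1 <= `|Zsum X N n w / a - 1| then 1 else 0)
    (deviation_prob N n a).
Proof. by apply: has_mean_prob; exact: measurable_deviation. Qed.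

(** As [Zsum] is nonnegative, the ratio is at most 0 and stays at distance at least 1 from 1;
    [a = 0] is covered by the convention for division by zero. *)
Lemma deviation_prob_neg (N : nat -> nat) (n : nat) (a : R) : a <= 0 ->
  deviation_prob N n a = 1.
Proof.
move=> a0; rewrite /deviation_prob (_ : [set w | _] = setT) ?probability_setT//.
apply/seteqP; split => // w _ /=.
have Z0 : 0 <= Zsum X N n w by rewrite Zsum_row sumr_ge0// => i _; exact: expR_ge0.
have Za : Zsum X N n w / a <= 0 by rewrite mulr_ge0_le0// invr_le0.
by rewrite ler0_norm; lra.
Qed.

Lemma typical_bounds (N : nat -> nat) (n : nat) (a : R) w : 0 < a ->
  ~~ (2^-1 <= `|Zsum X N n w / a - 1|) ->
  (a / 2 <= Zsum X N n w) /\
  {in iota 0 (N n), forall i, row_sum X (row n i) w <= ln (2 * a)}.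
Proof.
move=> a0; rewrite -ltNge ltr_distl => /andP[h1 h2].
have {}h1 : a / 2 <= Zsum X N n w.
  have : 2^-1 < Zsum X N n w / a by lra.
  by rewrite ltr_pdivlMr// mulrC => /ltW.
have {}h2 : Zsum X N n w <= 2 * a.
  have : Zsum X N n w / a < 2 by lra.
  by rewrite ltr_pdivrMr// => /ltW.
split => // i iN; rewrite -ler_expR lnK ?posrE ?mulr_gt0//.
apply: le_trans h2; rewrite Zsum_row (big_rem i)//= lerDl.
by apply: sumr_ge0 => j _; exact: expR_ge0.
Qed.

(** Off the deviation event no term is cut by the truncation, so [Zsum] equals the truncated sum and
    is at least [a / 2]; on that event the constant [a] itself is the bound. *)
Lemma one_le_deviation_trunc (N : nat -> nat) (n : nat) (a K : R) (f : nat -> R) :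
  0 < a -> 0 <= K ->
  (forall i, has_mean P (trunc_exp X (row n i) (ln (2 * a) + K)) (f i)) ->
  a <= a * deviation_prob N n a + 2 * \sum_(i <- iota 0 (N n)) f i.
Proof.
move=> a0 K0 hf.
have hsum : has_mean P (fun w => \sum_(i <- iota 0 (N n))
    trunc_exp X (row n i) (ln (2 * a) + K) w) (\sum_(i <- iota 0 (N n)) f i).
  elim: (iota 0 (N n)) => [|i t IH].
    by rewrite big_nil; apply: eq_has_mean (has_mean_cst 0 _) => // w; rewrite big_nil.
  rewrite big_cons; apply: eq_has_mean (has_meanD _ _ _ _ (hf i) IH) => w.
  by rewrite big_cons.
have two0 : 0 <= 2 :> R by [].
apply: (has_mean_le _ _ _ _ (has_mean_cst a (ltW a0)) (has_meanD _ _ _ _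
  (has_meanZ _ _ _ (ltW a0) (has_mean_deviation N n a)) (has_meanZ _ _ _ two0 hsum))) => w.
have S0 : 0 <= \sum_(i <- iota 0 (N n)) trunc_exp X (row n i) (ln (2 * a) + K) w.
  by apply: sumr_ge0 => i _; have /andP[] := trunc_exp_bounds X (row n i) (ln (2 * a) + K) w.
case: ifPn => [_|/(typical_bounds _ _ _ _ a0)[aZ hS]].
  by rewrite mulr1 lerDl mulr_ge0.
rewrite mulr0 add0r -ler_pdivrMl// mulrC (le_trans aZ)// Zsum_row.
rewrite le_eqVlt; apply/orP; left; apply/eqP; apply: eq_big_seq => i iN.
by rewrite /trunc_exp (le_trans (hS i iN)) ?lerDl.
Qed.

Lemma concentration_bound (c theta v M K kappa C r e r' : R) (N : nat -> nat)
    (n : nat) (a : R) :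
  (0 < n)%N -> 0 < a -> 0 < theta < 1 -> 0 < M -> 0 <= K -> 0 < kappa -> 0 <= C ->
  0 <= r ->
  c + ln M = theta * v ->
  (forall s z, uniq s -> (0 < size s)%N ->
    exists2 f, has_mean P (trunc_exp X s z) f &
      kappa * f <= expR z * row_tail X s (z - K) +
        C * (expR ((1 - theta) * z) * (M * r) ^+ size s)) ->
  (forall s, uniq s -> 1 - 2 * r' ^+ size s <=
        expR c ^+ size s * row_tail X s ((v - e) * (size s)%:R)) ->
  deviation_prob N n a < 8^-1 ->
  r' ^+ n <= 4^-1 ->
  2^-1 <= expR (- (c * n%:R)) * (N n)%:R <= 2 ->
  kappa <= 16 * expR K * deviation_prob N n a +
    8 * (C * expR K) * (expR (theta * e) * r) ^+ n * 2.
Proof.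
move=> n0 a0 /andP[theta0 theta1] M0 K0 kappa0 C0 r0 vE htrunc htail.
set b := deviation_prob N n a => b8 r'n /andP[y1 y2].
set y := expR (- (c * n%:R)) * (N n)%:R in y1 y2.
pose x := ln (2 * a).
have xE : expR x = 2 * a by rewrite lnK// posrE mulr_gt0.
have b0 : 0 <= b := has_mean_ge0 _ _ (has_mean_deviation N n a).
have sigma_le : \sum_(i <- iota 0 (N n)) row_tail X (row n i) x <= 2 * b.
  apply: (sum_row_tail_le X n _ x (fun w => 2^-1 <= `|Zsum X N n w / a - 1|)) => //.
  - exact: X_copies.1.
  - exact: iota_uniq.
  - exact: has_mean_deviation.
  - by lra.
  - by move=> w /(typical_bounds _ _ _ _ a0)[].
have Nsum (g : R) : \sum_(i <- iota 0 (N n)) g = (N n)%:R * g.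
  by rewrite big_const_seq count_predT size_iota iter_addr_0 mulr_natl.
(* Otherwise every row would exceed [x] with probability at least [expR (- (c * n)) / 2], and the
   sum of the tails would be at least [y / 2 >= 4^-1], against [2 * b < 4^-1]. *)
have x_ge : (v - e) * n%:R <= x.
  rewrite leNgt; apply/negP => xlt.
  have tail_ge i : expR (- (c * n%:R)) * 2^-1 <= row_tail X (row n i) x.
    have := htail (row n i) (uniq_row n i); rewrite size_row => hti.
    have mono : row_tail X (row n i) ((v - e) * n%:R) <= row_tail X (row n i) x.
      apply: (has_mean_le _ _ _ _ (has_mean_row_tail X _ _) (has_mean_row_tail X _ _)) => w.
      case: ifPn => [hw|_]; last by case: ifP.
      by rewrite (lt_trans xlt hw).
    apply: le_trans mono; rewrite expRN mulrC ler_pdivrMr ?expR_gt0// mulrC.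
    move: hti; rewrite -expRM_natl (mulrC n%:R) => hti.
    by apply: le_trans hti; lra.
  have : \sum_(i <- iota 0 (N n)) (expR (- (c * n%:R)) * 2^-1) <= 2 * b.
    by apply: le_trans sigma_le; apply: ler_sum => i _; exact: tail_ge.
  rewrite Nsum mulrA (mulrC (N n)%:R) -/y; lra.
have [f hf] : exists f : nat -> R, forall i,
    has_mean P (trunc_exp X (row n i) (x + K)) (f i) /\
    kappa * f i <= expR (x + K) * row_tail X (row n i) x +
      C * (expR ((1 - theta) * (x + K)) * (M * r) ^+ n).
  have hex i : exists f, has_mean P (trunc_exp X (row n i) (x + K)) f /\
      kappa * f <= expR (x + K) * row_tail X (row n i) x +
        C * (expR ((1 - theta) * (x + K)) * (M * r) ^+ n).
    have [|f hf1 hf2] := htrunc (row n i) (x + K) (uniq_row n i); first by rewrite size_row.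
    by exists f; split => //; rewrite addrK size_row in hf2.
  by exists (fun i => projT1 (cid (hex i))) => i; exact: projT2 (cid (hex i)).
have aF := one_le_deviation_trunc N n a K f a0 K0 (fun i => (hf i).1).
rewrite -/b in aF.
set F := \sum_(i <- _) f i in aF.
set err := expR ((1 - theta) * (x + K)) * (M * r) ^+ n.
have kF : kappa * F <= expR (x + K) * (2 * b) + (N n)%:R * (C * err).
  rewrite mulr_sumr -Nsum.
  apply: (@le_trans _ _ (\sum_(i <- iota 0 (N n))
      (expR (x + K) * row_tail X (row n i) x + C * err))).
    by apply: ler_sum => i _; exact: (hf i).2.
  by rewrite big_split /= lerD2r -mulr_sumr ler_wpM2l ?expR_ge0.
(* Factoring out [expR (x + K)] leaves [expR (- (theta * (x + K)))]. By [x_ge] and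
   [c + ln M = theta * v] this absorbs the growth of [N n] and [M ^+ n] up to [expR (theta * e)] per
   summand. *)
have err_le : (N n)%:R * err <= 2 * a * expR K * (2 * (expR (theta * e) * r) ^+ n).
  have -> : (N n)%:R = y * expR (c * n%:R).
    by rewrite /y mulrAC -expRD addNr expR0 mul1r.
  have -> : err = 2 * a * expR K * (expR (- (theta * (x + K))) * (M * r) ^+ n).
    rewrite /err mulrA -xE -!expRD; congr (expR _ * _); ring.
  rewrite mulrCA ler_wpM2l ?mulr_ge0 ?expR_ge0 ?(ltW a0)//.
  rewrite -mulrA; apply: ler_pM => //.
  - by rewrite (le_trans _ y1)// invr_ge0.
  - apply: mulr_ge0; rewrite ?expR_ge0//; apply: mulr_ge0; rewrite ?expR_ge0//.
    by apply: exprn_ge0; apply: mulr_ge0 => //; exact: ltW.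
  rewrite !exprMn !mulrA ler_wpM2r ?exprn_ge0//.
  have -> : M ^+ n = expR (n%:R * ln M) by rewrite expRM_natl lnK.
  rewrite -expRM_natl -!expRD ler_expR.
  have : theta * ((v - e) * n%:R) <= theta * (x + K).
    by rewrite ler_wpM2l ?(ltW theta0)// (le_trans x_ge)// lerDl.
  have : n%:R * (c + ln M) = n%:R * (theta * v) by rewrite vE.
  move: (ln M) n%:R => m k; lra.
have kF2 : kappa * F <= 4 * a * expR K * b + C * (2 * a * expR K * (2 * (expR (theta * e) * r) ^+ n)).
  apply: (le_trans kF); rewrite lerD//.
    by rewrite expRD xE le_eqVlt; apply/orP; left; apply/eqP; ring.
  by rewrite mulrCA ler_wpM2l.
(* With [b < 8^-1], the bound [a <= a * b + 2 * F] leaves at least this much to the truncated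
   means. *)
have F4 : a / 4 <= F.
  have : a * b <= a * 8^-1 by rewrite ler_wpM2l ?ltW.
  by lra.
have := ler_wpM2l (ltW kappa0) F4.
set Q := (expR (theta * e) * r) ^+ n in kF2 *.
move=> hk; have {}hk := le_trans hk kF2.
rewrite -(ler_pM2r a0); move: hk; move: (expR K) => E hk; lra.
Qed.

End Concentration.

(** * Contradiction in the limit *)

Theorem mainTheorem9 (R : realType)
    (d0 : measure_display) (T0 : measurableType d0) (P0 : probability T0 R)
    (X0 : {RV P0 >-> R})
    (d : measure_display) (T : measurableType d) (P : probability T R)
    (X : nat * nat -> {RV P >-> R})
    (c : R) (N : nat -> nat)
    (X0_nondegenerate : nondegenerate_rv P0 X0)
    (cgf_finite : forall t : R, 0 <= t -> cgf P0 X0 t \is a fin_num)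
    (c_gt0 : 0 < c) (c_lt_c1 : c < critical_rate P0 X0)
    (X_copies : independent_copies X X0)
    (N_asymp : expR (- (c * n%:R)) * (N n)%:R @[n --> \oo] --> (1 : R)) :
  ~ exists a : nat -> R,
      (forall n, a n != 0) /\
      cvg_in_probability P (fun n w => Zsum X N n w / a n) 1.
Proof.
move=> [a [a_neq0 Z_cvg]].
have [theta [v [theta01 vE htail]]] := critical_row_tail X0 X X_copies c cgf_finite c_gt0 c_lt_c1.
have [theta0 theta1] := andP theta01.
pose M := exp_moment X0 0 theta.
have M0 : 0 < M by apply: exp_moment0_gt0 => //; exact: ltW.
have hM : has_mean P0 (fun w => expR (theta * X0 w)) M.
  split.
  - by apply: measurableT_comp => //; apply: measurable_funM => //; exact: measurable_funP.
  - by move=> w; exact: expR_ge0.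
  - by apply: exp_moment0E => //; exact: ltW.
have theta01' : 0 <= theta < 1 by rewrite ltW.
have [K [kappa [C [r [K0 kappa0 C0 /andP[r0 r1] htrunc]]]]] :=
  row_trunc_mean_le X0 X X_copies theta M X0_nondegenerate theta01' M0 hM.
(* For [r > 0] this [e] makes the product equal to [expR (ln r / 2)], the square root of [r], so the
   error still decays geometrically; for [r = 0] any positive [e] would do. *)
have [e e0 q1] : exists2 e, 0 < e & expR (theta * e) * r < 1.
  have [->|r_neq0] := eqVneq r 0; first by exists 1; rewrite ?mulr0.
  have r_gt0 : 0 < r by rewrite lt0r r_neq0.
  exists (- ln r / (2 * theta)).
    by rewrite divr_gt0 ?mulr_gt0// oppr_gt0 ln_lt0// r_gt0.
  have -> : expR (theta * (- ln r / (2 * theta))) * r = expR (ln r / 2).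
    rewrite -{2}(lnK r_gt0) -expRD; congr expR.
    by field; rewrite gt_eqF.
  by rewrite -expR0 ltr_expR pmulr_llt0 ?invr_gt0// ln_lt0// r_gt0.
have [r' /andP[r'0 r'1] htail'] := htail e e0.
set q := expR (theta * e) * r in q1.
have q0 : 0 <= q by rewrite mulr_ge0 ?expR_ge0.
pose b n := deviation_prob X N n (a n).
have b_cvg : b n @[n --> \oo] --> 0.
  have half_gt0 : 0 < 2^-1 :> R by rewrite invr_gt0.
  by have /fine_cvgP[_] := Z_cvg _ half_gt0.
have q_cvg : q ^+ n @[n --> \oo] --> 0 by apply: cvg_expr; rewrite ger0_norm.
have r'_cvg : r' ^+ n @[n --> \oo] --> 0 by apply: cvg_expr; rewrite ger0_norm.
(* This is the upper bound that [concentration_bound] gives for the fixed positive number [kappa];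
   its vanishing is the contradiction. *)
have err_cvg : 16 * expR K * b n + 8 * (C * expR K) * q ^+ n * 2 @[n --> \oo] --> 0.
  rewrite [X in _ --> X](_ : 0 = 16 * expR K * 0 + 8 * (C * expR K) * 0 * 2); last by ring.
  by apply: cvgD; [|apply: cvgM; [|exact: cvg_cst]]; apply: cvgM => //; exact: cvg_cst.
have two_gt1 : 1 < 2 :> R by rewrite ltr1n.
have half_lt1 : 2^-1 < 1 :> R by rewrite invf_lt1.
have quarter_gt0 : 0 < 4^-1 :> R by rewrite invr_gt0.
have eighth_gt0 : 0 < 8^-1 :> R by rewrite invr_gt0.
suff : \forall n \near \oo, False by case=> n _ /(_ n (leqnn n)).
near=> n.
have n0 : (0 < n)%N by near: n; exists 1%N.
have b8 : b n < 8^-1 by near: n; exact: cvgr_lt b_cvg _ eighth_gt0.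
have r'4 : r' ^+ n <= 4^-1 by apply: ltW; near: n; exact: cvgr_lt r'_cvg _ quarter_gt0.
have N1 : 2^-1 <= expR (- (c * n%:R)) * (N n)%:R.
  by apply: ltW; near: n; exact: cvgr_gt N_asymp _ half_lt1.
have N2 : expR (- (c * n%:R)) * (N n)%:R <= 2.
  by apply: ltW; near: n; exact: cvgr_lt N_asymp _ two_gt1.
have err_lt : 16 * expR K * b n + 8 * (C * expR K) * q ^+ n * 2 < kappa.
  by near: n; exact: cvgr_lt err_cvg _ kappa0.
(* A nonpositive [a n] would have deviation probability 1, which [b8] excludes. *)
have a0 : 0 < a n.
  rewrite ltNge; apply/negP => /(deviation_prob_neg X N n) b1.
  by move: b8; rewrite /b b1 ltNge invf_le1// ler1n.
have N12 : 2^-1 <= expR (- (c * n%:R)) * (N n)%:R <= 2 by rewrite N1 N2.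
have := concentration_bound X0 X X_copies c theta v M K kappa C r e r' N n (a n)
  n0 a0 theta01 M0 K0 kappa0 C0 r0 vE htrunc htail' b8 r'4 N12.
by rewrite leNgt err_lt.
Unshelve. all: by end_near. Qed.
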